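(* Let $c\in\mathbb{R}$ with $0<|c|<0.1$, let $k_0\in\mathbb{N}$, $k_0\ge 2$, $\eta>0$, and let $\xi=\frac{\eta}{k_0^2}\gg 1$. Let $u=(u(k))_{k\in\mathbb{Z}}$ be the solution of $$\partial_t u(k)+a(k+1)\,u(k+1)-a(k-1)\,u(k-1)=0,\qquad k\in\mathbb{Z},$$ on $(t_0,t_1)=\left(-\frac{k_0}{2(k_0+1)},\frac{k_0}{2(k_0-1)}\right)$, where $$a(k)=a(k,t)=\frac{c}{\eta^{-2}k_0^2k^2+\left(k_0-k-\frac{k}{k_0}t\right)^2}$$ (so that in particular $a(k_0)=\frac{c}{\xi^{-2}+t^2}$). Suppose that at time $t_0$ it holds that $u(k_0)\ge 0.5\max_k|u(k)|=:0.5\,\theta$, and define $\gamma=\sqrt{1-8c^2}$. Then there exists a constant $C>0$ such that at time $t=t_1$ $$|u(k)|\le C\,\xi^{\gamma}\,\theta\quad\text{for all }k,$$ and $$|u(k_0-1)|\ge \frac{C}{2}\,\xi^{\gamma}\,\theta .$$ In particular, $|u(k_0-1)|\ge 0.5\max_k|u(k)|$ at time $t_1$, so that the theorem can be applied again (with $k_0$ replaced by $k_0-1$).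
   Context: $\xi\gg 1$ means that $\xi$ is sufficiently large (in dependence on $c$). The system is the Fourier-side form, at a fixed frequency $\eta$ in $y$, of the linearization of the 2D Euler equations around Couette flow perturbed by $c\cos(x)$: $u(k)$ is the Fourier mode $(k,\eta)$ of the vorticity, in a time variable $t$ rescaled and centered at the resonant time of mode $k_0$. *)

(* Defs.v *)
From Stdlib Require Import Reals ZArith.
From Coquelicot Require Import Coquelicot.
Open Scope R_scope.

Definition coef (c eta : R) (k0 k : Z) (t : R) : R :=
  c / (/ eta ^ 2 * IZR k0 ^ 2 * IZR k ^ 2
       + (IZR k0 - IZR k - IZR k / IZR k0 * t) ^ 2).

Definition tstart (k0 : Z) : R := - (IZR k0 / (2 * (IZR k0 + 1))).
Definition tend (k0 : Z) : R := IZR k0 / (2 * (IZR k0 - 1)).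

Definition xi (eta : R) (k0 : Z) : R := eta / IZR k0 ^ 2.

Definition gamma (c : R) : R := sqrt (1 - 8 * c ^ 2).

(* [m] is the l^infty norm of [v].  A least upper bound rather than an attained
   maximum, since a general bounded sequence need not attain it. *)
Definition is_max_mod (v : Z -> C) (m : R) : Prop :=
  is_lub (fun x => exists k : Z, x = Cmod (v k)) m.

(* [x <= z] for real [x] and complex [z]; as usual this says that [z] is real. *)
Definition Rle_C (x : R) (z : C) : Prop := Im z = 0 /\ x <= Re z.

(* The uniform bound is part of the notion of solution: without any growth
   condition as |k| -> infinity, the infinite system also has nonzero solutions
   with zero initial data, built from flat functions of [t]. *)
Definition is_solution (c eta : R) (k0 : Z) (u : Z -> R -> C) : Prop :=
  (forall k, continuous_on (fun t => tstart k0 <= t <= tend k0) (u k)) /\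
  (exists M, forall k t, tstart k0 <= t <= tend k0 -> Cmod (u k t) <= M) /\
  (forall k t, tstart k0 < t < tend k0 ->
     exists du : C,
       is_derive (u k) t du /\
       (du + coef c eta k0 (k + 1) t * u (k + 1)%Z t
           - coef c eta k0 (k - 1) t * u (k - 1)%Z t)%C = 0).

(* Main.v *)
Require Import Defs.
From Stdlib Require Import Reals ZArith Lra Lia Psatz.
From Coquelicot Require Import Coquelicot.
Open Scope R_scope.

(** Write l = k - k0, e = 1 / xi, j = 1 / k0. On the time interval considered every coefficient a(k0 + l)
    with l <> 0 has size at most 4 |c|, while a(k0) = c / (e^2 + t^2) is large for t near 0. So the dynamics
    is essentially that of f = u(k0) and of the jump v = u(k0 - 1) - u(k0 + 1), which satisfy, up to bounded
    couplings, f' = c v and v' = - 2 c f / (e^2 + t^2). For |t| >> e the solutions of this model are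
    combinations of |t|^g and |t|^(1-g), where g (1 - g) = 2 c^2 and 1 - 2 g = gamma. A solution of size 1 at
    the initial time arrives at the resonance along the first one, with f of size e^g; the resonance rotates
    it into the second one, so that v has size e^(g-1) just after it, and still size e^(2g-1) = xi^gamma at
    the final time. There u(k0 - 1) and u(k0 + 1) are almost opposite and carry half of v each; the other modes
    are smaller by a factor of order c.

    The proof makes this quantitative without solving the model. With rad = sqrt (e^2 + t^2) and
    rho = rad + |t|, the combination ((1 - g) f + c rad v) / rho^g before the resonance (decaying, written in
    reflected time) and (c rad v - g f) rho^g / rad after it (growing) have derivatives which are integrable
    uniformly in e: inward_drift, outward_drift. The other modes are controlled in the sup norm only: their
    coefficients are so small that the supremum of the tail can be absorbed. All bounds are closed by
    self_improving_bound: a finite supremum that is at most B plus a fraction of itself.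

    Before the resonance, inward_conclusion gives upper bounds for all modes, and a lower bound for f when f
    starts above half the maximum. After it, outward_conclusion gives the size of u(k0 - 1) and, by
    jump_profile, the bound of all modes by 1.6 |u(k0 - 1)| plus a term of lower order xi^(1/2), for every
    solution. Being inequalities between linear functionals, these pass from real to complex solutions by
    taking real components. The constant K of the theorem is 2 |u(k0 - 1)| / (xi^gamma theta), and both its
    bounds come from the estimates of u(k0 - 1).

    The reflection of t and l, which changes j into - j, lets the same coefficient estimates serve on
    both sides of the resonance (half_flow). *)

(** * Increments, bootstrap and elementary inequalities *)

Lemma increment_le (h phi dh dphi : R -> R) (a b : R) :
  a <= b ->
  (forall t, a <= t <= b -> continuous h t) ->
  (forall t, a <= t <= b -> continuous phi t) ->
  (forall t, a < t < b -> is_derive h t (dh t)) ->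
  (forall t, a < t < b -> is_derive phi t (dphi t)) ->
  (forall t, a < t < b -> dh t <= dphi t) ->
  h b - h a <= phi b - phi a.
Proof.
  intros hab ch cphi Dh Dphi le.
  destruct (MVT_gen (fun t => phi t - h t) a b
              (fun t => Rmax 0 (dphi t - dh t))) as [x [_ Hx]].
  - rewrite Rmin_left, Rmax_right by lra. intros t Ht.
    rewrite Rmax_right by (specialize (le t Ht); lra).
    apply (is_derive_minus (K := R_AbsRing) (V := R_NormedModule)); auto.
  - rewrite Rmin_left, Rmax_right by lra. intros t Ht.
    apply continuity_pt_filterlim.
    apply (continuous_minus (K := R_AbsRing) (V := R_NormedModule)); auto.
  - pose proof (Rmax_l 0 (dphi x - dh x)).
    assert (0 <= Rmax 0 (dphi x - dh x) * (b - a)) by (apply Rmult_le_pos; lra).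
    lra.
Qed.

(** The only integration tool of the proof: every estimate on the solution is obtained by exhibiting an
    explicit antiderivative phi of a bound for the slope. *)
Lemma increment_abs_le (h phi dh dphi : R -> R) (a b : R) :
  a <= b ->
  (forall t, a <= t <= b -> continuous h t) ->
  (forall t, a <= t <= b -> is_derive phi t (dphi t)) ->
  (forall t, a < t < b -> is_derive h t (dh t)) ->
  (forall t, a < t < b -> Rabs (dh t) <= dphi t) ->
  Rabs (h b - h a) <= phi b - phi a.
Proof.
  intros hab ch Dphi Dh le.
  assert (cphi : forall t, a <= t <= b -> continuous phi t).
  { intros t Ht. apply (ex_derive_continuous (V := R_NormedModule)).
    exists (dphi t). auto. }
  apply Rabs_le. split.
  - assert (- h b - - h a <= phi b - phi a); [|lra].
    apply (increment_le (fun t => - h t) phi (fun t => - dh t) dphi); auto.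
    + intros t Ht. apply (continuous_opp (K := R_AbsRing) (V := R_NormedModule)); auto.
    + intros t Ht. apply (is_derive_opp (K := R_AbsRing) (V := R_NormedModule)); auto.
    + intros t Ht. apply Dphi; lra.
    + intros t Ht. specialize (le t Ht). apply Rabs_le_between in le. lra.
  - apply (increment_le h phi dh dphi); auto.
    + intros t Ht. apply Dphi; lra.
    + intros t Ht. specialize (le t Ht). apply Rabs_le_between in le. lra.
Qed.

(** A linear bootstrap. The least upper bound K of h satisfies K <= B + r K, so an a priori bound that
    is finite but arbitrarily bad improves to one that depends on B and r only. *)
Lemma self_improving_bound (I : Type) (D : I -> Prop) (h : I -> R) (B r : R) :
  0 <= B -> 0 <= r < 1 ->
  (exists M, forall i, D i -> h i <= M) ->
  (forall K, 0 <= K -> (forall i, D i -> h i <= K) ->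
     forall i, D i -> h i <= B + r * K) ->
  forall i, D i -> h i <= B / (1 - r).
Proof.
  intros HB Hr [M HM] Himp i Di.
  destruct (completeness (fun x => x = 0 \/ exists i, D i /\ x = h i)) as [K [Kub Klub]].
  - exists (Rmax 0 M). intros x [-> | [k [Dk ->]]].
    + apply Rmax_l.
    + apply Rle_trans with (2 := Rmax_r 0 M); auto.
  - exists 0; auto.
  - assert (K0 : 0 <= K) by (apply Kub; auto).
    assert (HK : forall k, D k -> h k <= K) by (intros k Dk; apply Kub; right; eauto).
    assert (K <= B + r * K).
    { apply Klub. intros x [-> | [k [Dk ->]]].
      - assert (0 <= r * K) by (apply Rmult_le_pos; lra). lra.
      - apply Himp; auto. }
    apply Rle_trans with K; auto.
    apply Rle_div_r; [lra|]. lra.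
Qed.

Lemma Rabs_add_le (a b x y : R) : Rabs a <= x -> Rabs b <= y -> Rabs (a + b) <= x + y.
Proof. intros. eapply Rle_trans; [apply Rabs_triang|lra]. Qed.

Lemma Rabs_sub_le (a b x y : R) : Rabs a <= x -> Rabs b <= y -> Rabs (a - b) <= x + y.
Proof. intros. apply Rabs_add_le; [assumption|]. now rewrite Rabs_Ropp. Qed.

Lemma Rabs_mul_le (a b x y : R) : Rabs a <= x -> Rabs b <= y -> Rabs (a * b) <= x * y.
Proof.
  intros. rewrite Rabs_mult. apply Rmult_le_compat; auto using Rabs_pos.
Qed.

Lemma Rabs_le_half_sum (p q N : R) :
  Rabs N <= 2 * Rabs q + Rabs (q - p - N) + Rabs (q + p).
Proof. split_Rabs; lra. Qed.

Lemma Rabs_other_le (p q N : R) :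
  2 * Rabs p <= Rabs N + Rabs (q - p - N) + Rabs (q + p).
Proof. split_Rabs; lra. Qed.

Lemma le_div (a b d : R) : 0 < d -> a * d <= b -> a <= b / d.
Proof. intros. apply Rle_div_r; assumption. Qed.

Lemma div_le (a b d : R) : 0 < d -> a <= b * d -> a / d <= b.
Proof. intros. apply Rle_div_l; assumption. Qed.

(** With X = x^s, write x = X Y and 1 = X Z. The inequality 1 + u <= exp u bounds Y and Z from below, and
    the sum of the two bounds with weights s and 1 - s is the claim. *)
Lemma Rpower_bernoulli (x s : R) :
  0 < x -> 0 <= s <= 1 -> Rpower x s <= 1 + s * (x - 1).
Proof.
  intros Hx Hs. unfold Rpower.
  set (L := ln x). replace x with (exp L) at 1 by (apply exp_ln; auto).
  pose proof (exp_ineq1_le (L - s * L)) as H1.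
  pose proof (exp_ineq1_le (- (s * L))) as H2.
  pose proof (exp_pos (s * L)) as H3.
  assert (E1 : exp L = exp (s * L) * exp (L - s * L))
    by (rewrite <- exp_plus; f_equal; ring).
  assert (E2 : 1 = exp (s * L) * exp (- (s * L)))
    by (rewrite <- exp_plus, <- exp_0; f_equal; ring).
  fold L.
  set (X := exp (s * L)) in *. set (Y := exp (L - s * L)) in *.
  set (Z := exp (- (s * L))) in *.
  rewrite E1.
  assert (X * (1 + (L - s * L)) * s <= X * Y * s).
  { apply Rmult_le_compat_r; [lra|]. apply Rmult_le_compat_l; lra. }
  assert (X * (1 + - (s * L)) * (1 - s) <= 1 * (1 - s)).
  { rewrite E2. apply Rmult_le_compat_r; [lra|]. apply Rmult_le_compat_l; lra. }
  nra.
Qed.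

Lemma Rpower_ratio_le (x y s r : R) :
  0 < x <= y -> s <= r -> Rpower y s / Rpower y r <= Rpower x s / Rpower x r.
Proof.
  intros Hxy Hs.
  unfold Rdiv. rewrite <- !Rpower_Ropp, <- !Rpower_plus.
  replace (s + - r) with (- (r - s)) by ring.
  rewrite !Rpower_Ropp.
  apply Rinv_le_contravar; [apply exp_pos|].
  apply Rle_Rpower_l; lra.
Qed.

(** * Weights at the resonance *)

(** The scale rad replaces |t| near the resonance, where 1/t^2 is cut off at |t| = e. The point of rho
    is rho' = rho / rad: its powers are exact antiderivatives, and are comparable to powers of t
    for t >= e. *)
Definition rad (e t : R) : R := sqrt (e ^ 2 + t ^ 2).
Definition rho (e t : R) : R := rad e t + t.
Definition pw (e s t : R) : R := Rpower (rho e t) s.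

Section Weights.
Context (e : R) (He : 0 < e).

Lemma rad_sq t : rad e t * rad e t = e ^ 2 + t ^ 2.
Proof. unfold rad. apply sqrt_sqrt. nra. Qed.

Lemma rad_pos t : 0 < rad e t.
Proof. apply sqrt_lt_R0. nra. Qed.

Lemma rad_bounds t : 0 <= t -> e <= rad e t /\ t <= rad e t <= e + t.
Proof.
  intros Ht. pose proof (rad_sq t). pose proof (rad_pos t).
  repeat split; nra.
Qed.

Lemma rho_bounds t : 0 <= t ->
  rad e t <= rho e t <= 2 * rad e t /\ e <= rho e t /\
  2 * t <= rho e t <= 2 * t + e.
Proof. intros Ht. unfold rho. destruct (rad_bounds t Ht). lra. Qed.

Lemma rho_pos t : 0 < rho e t.
Proof.
  unfold rho. pose proof (rad_sq t). pose proof (rad_pos t). nra.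
Qed.

(** The quantity 1 - t / rad = e^2 / (rad rho) measures how far rad is from t; its decay is what makes
    the region t >> e contribute a bounded amount. *)
Lemma rad_sub_rho t : (rad e t - t) * rho e t = e ^ 2.
Proof. unfold rho. pose proof (rad_sq t). nra. Qed.

Lemma rho_0 : rho e 0 = e.
Proof.
  unfold rho, rad. replace (e ^ 2 + 0 ^ 2) with (e ^ 2) by ring.
  rewrite sqrt_pow2; lra.
Qed.

Lemma rad_0 : rad e 0 = e.
Proof. pose proof rho_0 as H. unfold rho in H. lra. Qed.

Lemma pw_pos s t : 0 < pw e s t.
Proof. apply exp_pos. Qed.

Lemma is_derive_rad t : is_derive (fun t : R => rad e t) t (t / rad e t).
Proof.
  pose proof (rad_pos t). unfold rad in *.
  auto_derive; [nra|].
  replace (e * (e * 1) + t * (t * 1)) with (e ^ 2 + t ^ 2) by ring.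
  field. lra.
Qed.

Lemma is_derive_rho t : is_derive (fun t : R => rho e t) t (rho e t / rad e t).
Proof.
  pose proof (rad_pos t). unfold rho.
  auto_derive; [eexists; apply is_derive_rad|].
  rewrite (is_derive_unique _ _ _ (is_derive_rad t)). field. lra.
Qed.

Lemma is_derive_pw s t : is_derive (fun t : R => pw e s t) t (s * pw e s t / rad e t).
Proof.
  pose proof (rad_pos t). pose proof (rho_pos t). unfold pw, Rpower.
  auto_derive; [split; [eexists; apply is_derive_rho|auto]|].
  rewrite (is_derive_unique _ _ _ (is_derive_rho t)). field. lra.
Qed.

Lemma is_derive_sqrt_rho t :
  is_derive (fun t : R => sqrt (rho e t)) t (sqrt (rho e t) / (2 * rad e t)).
Proof.
  pose proof (rad_pos t). pose proof (rho_pos t).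
  pose proof (sqrt_lt_R0 _ H0) as Hs.
  auto_derive; [split; [eexists; apply is_derive_rho|auto]|].
  rewrite (is_derive_unique _ _ _ (is_derive_rho t)).
  replace (rho e t) with (sqrt (rho e t) * sqrt (rho e t)) at 1
    by (apply sqrt_sqrt; lra).
  field. lra.
Qed.

Lemma pw_le s t : 0 <= s <= 1 -> pw e s t <= 1 + s * (rho e t - 1).
Proof. intros. apply Rpower_bernoulli; auto. apply rho_pos. Qed.

Lemma inv_pw_le s t : 0 <= s <= 1 -> / pw e s t <= 1 + s * (/ rho e t - 1).
Proof.
  intros. unfold pw. pose proof (rho_pos t).
  replace (/ Rpower (rho e t) s) with (Rpower (/ rho e t) s).
  - apply Rpower_bernoulli; auto. apply Rinv_0_lt_compat; auto.
  - unfold Rpower. rewrite ln_Rinv by auto. rewrite <- exp_Ropp. f_equal. ring.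
Qed.

Lemma rho_incr s t : 0 <= s <= t -> rho e s <= rho e t.
Proof.
  intros. unfold rho. 
  assert (rad e s <= rad e t); [|lra].
  unfold rad. apply sqrt_le_1; nra.
Qed.

Lemma sqrt_le_start (s : R) : e < 1 -> s <= 1 / 2 -> sqrt e <= pw e s 0.
Proof.
  intros He1 Hs. unfold pw. rewrite rho_0, <- Rpower_sqrt by auto.
  assert (ln e < 0) by (rewrite <- ln_1; apply ln_increasing; lra).
  unfold Rpower. destruct (Req_dec (/ 2 * ln e) (s * ln e)) as [->|]; [lra|].
  apply Rlt_le, exp_increasing. nra.
Qed.

Lemma sqrt_small : e <= 1 / 1000000 -> 0 < sqrt e /\ 1000 <= / sqrt e.
Proof.
  intros He1. assert (Hh : 0 < sqrt e) by (apply sqrt_lt_R0; auto). split; auto.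
  replace 1000 with (/ (1 / 1000)) by field. apply Rinv_le_contravar; auto.
  replace (1 / 1000) with (sqrt (1 / 1000000)).
  - apply sqrt_le_1; lra.
  - replace (1 / 1000000) with ((1 / 1000) ^ 2) by field. apply sqrt_pow2. lra.
Qed.

End Weights.

Ltac wderive He :=
  auto_derive;
  [ repeat split;
    lazymatch goal with
    | |- ex_derive (fun x => sqrt (rho _ x)) _ => eexists; apply (is_derive_sqrt_rho _ He)
    | |- ex_derive (fun x => rad _ x) _ => eexists; apply (is_derive_rad _ He)
    | |- ex_derive (fun x => rho _ x) _ => eexists; apply (is_derive_rho _ He)
    | |- ex_derive (fun x => pw _ _ x) _ => eexists; apply (is_derive_pw _ He)
    | |- rad _ _ <> 0 => apply Rgt_not_eq, rad_pos, He
    | |- rho _ _ <> 0 => apply Rgt_not_eq, rho_pos, He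
    | |- pw _ _ _ <> 0 => apply Rgt_not_eq, pw_pos
    | |- 0 < rho _ _ => apply rho_pos, He
    | |- sqrt (rho _ _) <> 0 => apply Rgt_not_eq, sqrt_lt_R0, rho_pos, He
    | |- _ * _ <> 0 => apply Rmult_integral_contrapositive_currified;
        apply Rgt_not_eq; first [apply rho_pos, He | apply pw_pos | apply rad_pos, He]
    | |- True => exact I
    | |- _ => assumption
    end
  | repeat match goal with
      | |- context [Derive ?F ?t] =>
          lazymatch F with
          | fun x => rad ?e x => rewrite (is_derive_unique F t _ (is_derive_rad e He t))
          | fun x => rho ?e x => rewrite (is_derive_unique F t _ (is_derive_rho e He t))
          | fun x => pw ?e ?s x => rewrite (is_derive_unique F t _ (is_derive_pw e He s t))
          end
      end ].

(** * The half flow and its coefficients *)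

(** Here e is the inverse of xi, and g is the smaller exponent at the resonance: t^s solves the model
    equation t^2 f'' + 2 c^2 f = 0 when s (1 - s) = 2 c^2. The bound 41/2000 on g follows from c < 1/10. *)
Record regime (c e g : R) : Prop := {
  reg_c : 0 < c < 1 / 10;
  reg_e : 0 < e <= 1 / 1000000;
  reg_g : 0 < g <= 41 / 2000;
  reg_cg : g * (1 - g) = 2 * c ^ 2 }.

(** The interval between two consecutive mid-times, in the variable centred at the resonance, is
    [- half_time (- j), half_time j] with j the inverse of k0. *)
Definition half_time (j : R) : R := / (2 * (1 - j)).

(** The coefficient a(k0 + l), written with e and j only. It is invariant under changing the signs of
    j, l and t together. *)
Definition acoef (c e j : R) (l : Z) (t : R) : R :=
  c / (e ^ 2 * (1 + IZR l * j) ^ 2 + (IZR l + (1 + IZR l * j) * t) ^ 2).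

(** One side of the resonance, with the modes counted from the resonant one. A negative j describes the
    half before the resonance, after reflecting both t and l. *)
Record half_flow (c e j : R) (y : Z -> R -> R) : Prop := {
  hf_cont : forall l t, 0 <= t <= half_time j -> continuous (y l) t;
  hf_bdd : exists M, forall l t, 0 <= t <= half_time j -> Rabs (y l t) <= M;
  hf_der : forall l t, 0 < t < half_time j ->
    is_derive (y l) t (acoef c e j (l - 1) t * y (l - 1)%Z t
                       - acoef c e j (l + 1) t * y (l + 1)%Z t) }.

Section Coefficients.
Context (c e j t : R) (Hc : 0 < c) (He : 0 < e <= 1 / 1000000)
  (Hj : - (1 / 2) <= j <= 1 / 2) (Ht : 0 <= t <= half_time j).

Lemma half_time_bounds : (1 - j) * t <= 1 / 2 /\ t <= 1.
Proof.
  assert ((1 - j) * t <= 1 / 2).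
  { unfold half_time in Ht.
    replace (1/2) with ((1 - j) * / (2 * (1 - j))) by (field; lra).
    apply Rmult_le_compat_l; lra. }
  split; nra.
Qed.

(** At least 4/3 away from its own resonance, a mode feels a coefficient at most (9/16) c. *)
Lemma coef_far l : (2 <= Z.abs l)%Z -> 0 <= acoef c e j l t <= 6 / 10 * c.
Proof.
  intros Hl. destruct half_time_bounds as [H1 H2].
  unfold acoef. set (z := IZR l).
  assert (Hd : 16 / 9 <= (z + (1 + z * j) * t) ^ 2).
  { assert (z <= -2 \/ 2 <= z) as [Hz|Hz].
    { destruct (Z.le_gt_cases l 0).
      - left. apply IZR_le. lia.
      - right. apply IZR_le. lia. }
    - assert (4 / 3 <= - (z + (1 + z * j) * t)); [|nra].
      assert (0 <= (-2 - z) * (1 + j * t)) by (apply Rmult_le_pos; nra). nra.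
    - assert (4 / 3 <= z + (1 + z * j) * t); [|nra].
      assert (0 <= (z - 2) * (1 + j * t)) by (apply Rmult_le_pos; nra). nra. }
  assert (0 <= e ^ 2 * (1 + z * j) ^ 2) by (apply Rmult_le_pos; apply pow2_ge_0).
  split.
  - apply Rdiv_le_0_compat; nra.
  - apply div_le; nra.
Qed.

Lemma coef_0 : acoef c e j 0 t = c / (rad e t * rad e t).
Proof.
  unfold acoef. rewrite rad_sq by lra. f_equal. ring.
Qed.

Lemma coef_p1 : 0 <= acoef c e j 1 t <= c /\
  Rabs (acoef c e j 1 t - c) <= c * (2 * (1 + j) * t + 9 / 4 * e ^ 2).
Proof.
  destruct half_time_bounds as [H1 H2]. unfold acoef.
  set (E := e ^ 2 * (1 + 1 * j) ^ 2). set (s := (1 + j) * t).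
  replace (1 + (1 + 1 * j) * t) with (1 + s) by (unfold s; ring).
  assert (HE : 0 <= E <= 9 / 4 * e ^ 2).
  { unfold E. assert (0 <= (1 + 1 * j) ^ 2 <= 9 / 4) by nra.
    assert (0 < e ^ 2) by nra. nra. }
  assert (Hs : 0 <= s) by (unfold s; nra).
  assert (HD : 1 <= E + (1 + s) ^ 2) by nra.
  assert (Hu : c / (E + (1 + s) ^ 2) <= c) by (apply div_le; nra).
  assert (Hl : c * (1 - 2 * s - E) <= c / (E + (1 + s) ^ 2)).
  { apply le_div; [lra|]. rewrite Rmult_assoc.
    rewrite <- (Rmult_1_r c) at 2. apply Rmult_le_compat_l; [lra|].
    assert (0 <= s * E) by nra. assert (0 <= s * s) by nra.
    assert (0 <= s * (s * s)) by nra. assert (0 <= s * (s * E)) by nra. nra. }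
  repeat split; auto.
  - apply Rdiv_le_0_compat; lra.
  - replace (2 * (1 + j) * t) with (2 * s) by (unfold s; ring).
    apply Rabs_le. split; nra.
Qed.

(** This is the mode which becomes resonant next: its coefficient grows from c to 4 c. The linear bound
    is the chord of (1 - s)^(-2) on [0, 1/2]. *)
Lemma coef_m1 : 0 <= acoef c e j (-1) t <= 4 * c /\
  Rabs (acoef c e j (-1) t - c) <= c * (6 * (1 - j) * t + 9 / 4 * e ^ 2).
Proof.
  destruct half_time_bounds as [H1 H2]. unfold acoef.
  set (E := e ^ 2 * (1 + -1 * j) ^ 2). set (s := (1 - j) * t) in *.
  replace (-1 + (1 + -1 * j) * t) with (- (1 - s)) by (unfold s; ring).
  assert (HE : 0 <= E <= 9 / 4 * e ^ 2).
  { unfold E. assert (0 <= (1 + -1 * j) ^ 2 <= 9 / 4) by nra.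
    assert (0 < e ^ 2) by nra. nra. }
  assert (Hs : 0 <= s) by (unfold s; nra).
  assert (HE1 : E <= 1 / 1000) by nra.
  assert (HD : 1 / 4 <= E + (- (1 - s)) ^ 2) by nra.
  assert (Hu : c / (E + (- (1 - s)) ^ 2) <= c * (1 + 6 * s)).
  { apply div_le; [lra|]. rewrite Rmult_assoc.
    rewrite <- (Rmult_1_r c) at 1. apply Rmult_le_compat_l; [lra|].
    assert (0 <= s * (1 - 2 * s) * (4 - 3 * s)) by
      (apply Rmult_le_pos; [apply Rmult_le_pos|]; lra).
    assert (0 <= s * E) by nra. nra. }
  assert (Hl : c * (1 - E) <= c / (E + (- (1 - s)) ^ 2)).
  { apply le_div; [lra|]. rewrite Rmult_assoc.
    rewrite <- (Rmult_1_r c) at 2. apply Rmult_le_compat_l; [lra|].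
    assert ((- (1 - s)) ^ 2 <= 1) by nra.
    assert ((1 - E) * (E + (- (1 - s)) ^ 2) <= (1 - E) * (E + 1)) by
      (apply Rmult_le_compat_l; lra). nra. }
  repeat split.
  - apply Rdiv_le_0_compat; lra.
  - apply Rle_trans with (1 := Hu). nra.
  - replace (6 * (1 - j) * t) with (6 * s) by (unfold s; ring).
    apply Rabs_le. split; nra.
Qed.

End Coefficients.

Section Modes.
Context (c e j : R) (y : Z -> R -> R) (Hc : 0 < c)
  (He : 0 < e <= 1 / 1000000) (Hj : - (1 / 2) <= j <= 1 / 2)
  (Hy : half_flow c e j y).

Lemma derive_resonant t : 0 < t < half_time j ->
  is_derive (y 0%Z) t (acoef c e j (-1) t * y (-1)%Z t
                       - acoef c e j 1 t * y 1%Z t).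
Proof. intros Ht. exact (hf_der _ _ _ _ Hy 0%Z t Ht). Qed.

Lemma derive_p1 t : 0 < t < half_time j ->
  is_derive (y 1%Z) t (acoef c e j 0 t * y 0%Z t - acoef c e j 2 t * y 2%Z t).
Proof. intros Ht. exact (hf_der _ _ _ _ Hy 1%Z t Ht). Qed.

Lemma derive_m1 t : 0 < t < half_time j ->
  is_derive (y (-1)%Z) t (acoef c e j (-2) t * y (-2)%Z t
                          - acoef c e j 0 t * y 0%Z t).
Proof. intros Ht. exact (hf_der _ _ _ _ Hy (-1)%Z t Ht). Qed.

(** The resonant mode drives its two neighbours with opposite signs, so it cancels in their sum. *)
Lemma derive_side_sum t : 0 < t < half_time j ->
  is_derive (fun s => y (-1)%Z s + y 1%Z s) t
    (acoef c e j (-2) t * y (-2)%Z t - acoef c e j 2 t * y 2%Z t).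
Proof.
  intros Ht.
  replace (acoef c e j (-2) t * y (-2)%Z t - acoef c e j 2 t * y 2%Z t) with
    ((acoef c e j (-2) t * y (-2)%Z t - acoef c e j 0 t * y 0%Z t)
     + (acoef c e j 0 t * y 0%Z t - acoef c e j 2 t * y 2%Z t)) by ring.
  apply (is_derive_plus (K := R_AbsRing) (V := R_NormedModule)).
  - apply derive_m1; auto.
  - apply derive_p1; auto.
Qed.

Lemma side_sum_increment (beta a b : R) :
  0 <= a <= b -> b <= half_time j ->
  (forall l s, (2 <= Z.abs l)%Z -> 0 <= s <= half_time j ->
     Rabs (acoef c e j l s * y l s) <= beta) ->
  Rabs ((y (-1)%Z b + y 1%Z b) - (y (-1)%Z a + y 1%Z a)) <= 2 * beta * (b - a).
Proof.
  intros Hab Hb Hfar.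
  replace (2 * beta * (b - a)) with (2 * beta * b - 2 * beta * a) by ring.
  apply (increment_abs_le (fun s => y (-1)%Z s + y 1%Z s) (fun s => 2 * beta * s)
    (fun s => acoef c e j (-2) s * y (-2)%Z s - acoef c e j 2 s * y 2%Z s)
    (fun s => 2 * beta)).
  - lra.
  - intros s Hs. apply (continuous_plus (K := R_AbsRing) (V := R_NormedModule));
      apply (hf_cont _ _ _ _ Hy); lra.
  - intros s Hs. auto_derive; auto. ring.
  - intros s Hs. apply derive_side_sum. lra.
  - intros s Hs. replace (2 * beta) with (beta + beta) by ring.
    apply Rabs_sub_le; apply Hfar; lra || lia.
Qed.

Lemma far_term t B l : 0 <= t <= half_time j ->
  (forall k, (2 <= Z.abs k)%Z -> Rabs (y k t) <= B) ->
  (2 <= Z.abs l)%Z ->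
  Rabs (acoef c e j l t * y l t) <= 6 / 10 * c * B.
Proof.
  intros Ht HB Hl. rewrite Rabs_mult.
  destruct (coef_far c e j t Hc He Hj Ht l Hl) as [H1 H2].
  rewrite (Rabs_pos_eq _ H1).
  apply Rmult_le_compat; auto. apply Rabs_pos.
Qed.

(** A mode with |l| >= 2 has at most one neighbour among l = 1 and l = -1, and the resonant mode is never
    its neighbour: the strong coefficient does not act on the tail directly. *)
Lemma tail_slope t B beta l : 0 <= t <= half_time j ->
  (forall k, (2 <= Z.abs k)%Z -> Rabs (y k t) <= B) ->
  Rabs (acoef c e j 1 t * y 1%Z t) <= beta ->
  Rabs (acoef c e j (-1) t * y (-1)%Z t) <= beta ->
  (2 <= Z.abs l)%Z ->
  Rabs (acoef c e j (l - 1) t * y (l - 1)%Z t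
        - acoef c e j (l + 1) t * y (l + 1)%Z t) <= 12 / 10 * c * B + beta.
Proof.
  intros Ht HB H1 Hm1 Hl.
  assert (0 <= B) by (apply Rle_trans with (2 := HB 2%Z ltac:(lia)); apply Rabs_pos).
  assert (0 <= c * B) by nra.
  assert (0 <= beta) by (apply Rle_trans with (2 := H1); apply Rabs_pos).
  pose proof (far_term t B) as F.
  destruct (Z.eq_dec l 2) as [->|N2]; [|destruct (Z.eq_dec l (-2)) as [->|Nm2]].
  - change (2 - 1)%Z with 1%Z. pose proof (F (2 + 1)%Z Ht HB ltac:(lia)).
    eapply Rle_trans; [apply Rabs_sub_le; eassumption|]. lra.
  - change (-2 + 1)%Z with (-1)%Z. pose proof (F (-2 - 1)%Z Ht HB ltac:(lia)).
    eapply Rle_trans; [apply Rabs_sub_le; eassumption|]. lra.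
  - pose proof (F (l - 1)%Z Ht HB ltac:(lia)).
    pose proof (F (l + 1)%Z Ht HB ltac:(lia)).
    eapply Rle_trans; [apply Rabs_sub_le; eassumption|]. lra.
Qed.

End Modes.

(** * Approaching the resonance *)

Ltac rewrite_derivatives He D0 D1 Dm1 :=
  repeat match goal with
    | |- context [Derive ?F ?t] =>
        lazymatch F with
        | fun x => rad ?e x => rewrite (is_derive_unique F t _ (is_derive_rad e He t))
        | fun x => pw ?e ?s x => rewrite (is_derive_unique F t _ (is_derive_pw e He s t))
        | fun x => _ 0%Z x => rewrite (is_derive_unique F t _ D0)
        | fun x => _ 1%Z x => rewrite (is_derive_unique F t _ D1)
        | fun x => _ (-1)%Z x => rewrite (is_derive_unique F t _ Dm1)
        end
    end.

Section Inward.
Context (c e g j : R) (y : Z -> R -> R) (Hreg : regime c e g)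
  (Hj : - (1 / 2) <= j <= 0) (Hy : half_flow c e j y)
  (Hend : forall l, Rabs (y l (half_time j)) <= 1).

Let Hc : 0 < c. Proof. apply Hreg. Qed.
Let Hc1 : c < 1 / 10. Proof. apply Hreg. Qed.
Let He : 0 < e. Proof. apply Hreg. Qed.
Let He1 : 0 < e <= 1 / 1000000. Proof. apply Hreg. Qed.
Let Hg : 0 < g <= 41 / 2000. Proof. apply Hreg. Qed.
Let Hcg : g * (1 - g) = 2 * c ^ 2. Proof. apply Hreg. Qed.
Let Hj2 : - (1 / 2) <= j <= 1 / 2. Proof. lra. Qed.

Lemma inward_time : 1 / 3 <= half_time j <= 1 / 2.
Proof.
  unfold half_time. split.
  - apply Rle_trans with (/ 3); [lra|]. apply Rinv_le_contravar; lra.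
  - apply Rle_trans with (/ 2); [|lra]. apply Rinv_le_contravar; lra.
Qed.

(** The growth of the neighbours towards the resonance is near_gain K * rho^(g-1) if |f| <= K rho^g. The
    identity c * near_gain K = g K is what keeps the feedback of the neighbours on f and on the tail
    of size K, uniformly in e. *)
Definition near_gain (K : R) : R := 2 * c * K / (1 - g).

Lemma near_gain_bounds K : 0 <= K ->
  0 <= near_gain K /\ c * near_gain K = g * K /\ near_gain K <= 2042 / 10000 * K.
Proof.
  intros HK. unfold near_gain.
  assert (0 <= c * K) by nra.
  repeat split.
  - apply Rdiv_le_0_compat; lra.
  - transitivity (2 * c ^ 2 * K / (1 - g)); [field; lra|].
    rewrite <- Hcg. field. lra.
  - apply div_le; [lra|]. nra.
Qed.

Section Given.
Context (K B : R) (HK : 0 <= K)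
  (Hf : forall t, 0 <= t <= half_time j -> Rabs (y 0%Z t) <= K * pw e g t)
  (HB : forall l t, (2 <= Z.abs l)%Z -> 0 <= t <= half_time j -> Rabs (y l t) <= B).

Let k1 := near_gain K.
Let Q := 1 + 3 / 100 * B.

Lemma inward_B_nonneg : 0 <= B.
Proof.
  pose proof inward_time.
  apply Rle_trans with (2 := HB 2%Z 0 ltac:(lia) ltac:(lra)). apply Rabs_pos.
Qed.

Lemma resonant_term t : 0 <= t <= half_time j ->
  Rabs (acoef c e j 0 t * y 0%Z t) <= 2 * c * K * (pw e g t / rho e t) / rad e t.
Proof.
  intros Ht. rewrite coef_0 by lra.
  pose proof (rad_pos e He t). pose proof (rho_pos e He t).
  pose proof (pw_pos e g t). destruct (rho_bounds e He t (proj1 Ht)) as [[_ Hr] _].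
  rewrite Rabs_mult, Rabs_pos_eq by (apply Rdiv_le_0_compat; nra).
  apply Rle_trans with (c / (rad e t * rad e t) * (K * pw e g t)).
  - apply Rmult_le_compat_l; auto. apply Rdiv_le_0_compat; nra.
  - replace (c / (rad e t * rad e t) * (K * pw e g t))
      with (c * K * pw e g t / rad e t * (/ rad e t)) by (field; lra).
    replace (2 * c * K * (pw e g t / rho e t) / rad e t)
      with (c * K * pw e g t / rad e t * (2 * / rho e t)) by (field; lra).
    apply Rmult_le_compat_l.
    + apply Rdiv_le_0_compat; auto. apply Rmult_le_pos; nra.
    + replace (2 * / rho e t) with (/ (rho e t / 2)) by (field; lra).
      apply Rinv_le_contravar; lra.
Qed.

Lemma inward_near t : 0 <= t <= half_time j ->
  Rabs (y 1%Z t) <= Q + k1 * (pw e g t / rho e t) /\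
  Rabs (y (-1)%Z t) <= Q + k1 * (pw e g t / rho e t).
Proof.
  intros Ht. pose proof inward_time as HT. pose proof inward_B_nonneg as HB0.
  destruct (near_gain_bounds K HK) as [Hk1 _]. fold k1 in Hk1.
  set (phi := fun s : R => 6 / 100 * B * s - k1 * (pw e g s / rho e s)).
  set (dphi := fun s : R => 6 / 100 * B + 2 * c * K * (pw e g s / rho e s) / rad e s).
  assert (Dphi : forall s, t <= s <= half_time j -> is_derive phi s (dphi s)).
  { intros s Hs. unfold phi, dphi.
    pose proof (rad_pos e He s). pose proof (rho_pos e He s).
    wderive He. unfold k1, near_gain. field. lra. }
  assert (Hphi : phi (half_time j) - phi t <= 3 / 100 * B + k1 * (pw e g t / rho e t)).
  { unfold phi.
    assert (0 <= k1 * (pw e g (half_time j) / rho e (half_time j))).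
    { apply Rmult_le_pos; auto. apply Rlt_le, Rdiv_lt_0_compat;
        [apply pw_pos | apply rho_pos; auto]. }
    assert (0 <= B * t) by nra. nra. }
  assert (Hfar : forall l s, (2 <= Z.abs l)%Z -> 0 <= s <= half_time j ->
            Rabs (acoef c e j l s * y l s) <= 6 / 100 * B).
  { intros l s Hl Hs.
    pose proof (far_term c e j y Hc He1 Hj2 s B l Hs (fun k Hk => HB k s Hk Hs) Hl).
    nra. }
  split.
  - assert (Rabs (y 1%Z (half_time j) - y 1%Z t) <= phi (half_time j) - phi t).
    { apply (increment_abs_le _ _
        (fun s => acoef c e j 0 s * y 0%Z s - acoef c e j 2 s * y 2%Z s) dphi); auto.
      - lra.
      - intros s Hs. apply (hf_cont _ _ _ _ Hy); lra.
      - intros s Hs. apply derive_p1; auto; lra.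
      - intros s Hs. unfold dphi. rewrite Rplus_comm.
        apply Rabs_sub_le; [apply resonant_term; lra | apply Hfar; [lia|lra]]. }
    pose proof (Hend 1). unfold Q. split_Rabs; lra.
  - assert (Rabs (y (-1)%Z (half_time j) - y (-1)%Z t) <= phi (half_time j) - phi t).
    { apply (increment_abs_le _ _
        (fun s => acoef c e j (-2) s * y (-2)%Z s - acoef c e j 0 s * y 0%Z s) dphi); auto.
      - lra.
      - intros s Hs. apply (hf_cont _ _ _ _ Hy); lra.
      - intros s Hs. apply derive_m1; auto; lra.
      - intros s Hs. unfold dphi.
        apply Rabs_sub_le; [apply Hfar; [lia|lra] | apply resonant_term; lra]. }
    pose proof (Hend (-1)%Z). unfold Q. split_Rabs; lra.
Qed.

Lemma pw_le_1 t : 0 <= t <= half_time j -> pw e g t <= 1001 / 1000.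
Proof.
  intros Ht. pose proof inward_time as HT.
  destruct (rho_bounds e He t (proj1 Ht)) as [_ [_ Hr]].
  pose proof (pw_le e He g t ltac:(lra)). nra.
Qed.

(** Integrating c times the neighbours, which grow like rho^(g-1), looks like a logarithm of e. It is in fact
    K times the increment of rho^g, which is at most about K. *)
Lemma inward_tail l t : (2 <= Z.abs l)%Z -> 0 <= t <= half_time j ->
  Rabs (y l t) <= 121 / 100 + 11 / 10 * K + 7 / 100 * B.
Proof.
  intros Hl Ht. pose proof inward_time as HT. pose proof inward_B_nonneg as HB0.
  destruct (near_gain_bounds K HK) as [Hk1 [Hck1 _]]. fold k1 in Hk1, Hck1.
  assert (HgK : 0 <= g * K <= 41 / 2000 * K) by nra.
  set (m := 12 / 100 * B + 4 / 10 * Q + 5 * (g * K)).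
  set (phi := fun s : R => m * s + K * pw e g s).
  set (dphi := fun s : R => m + K * (g * pw e g s / rad e s)).
  assert (HQ : 0 <= Q) by (unfold Q; lra).
  assert (Rabs (y l (half_time j) - y l t) <= phi (half_time j) - phi t) as Hinc.
  { apply (increment_abs_le _ _ (fun s => acoef c e j (l - 1) s * y (l - 1)%Z s
        - acoef c e j (l + 1) s * y (l + 1)%Z s) dphi); auto.
    - lra.
    - intros s Hs. apply (hf_cont _ _ _ _ Hy); lra.
    - intros s Hs. unfold phi, dphi. pose proof (rad_pos e He s). wderive He. field. lra.
    - intros s Hs. apply (hf_der _ _ _ _ Hy); lra.
    - intros s Hs. assert (Hs' : 0 <= s <= half_time j) by lra.
      destruct (inward_near s Hs') as [N1 Nm1].
      destruct (coef_p1 c e j s Hc He1 Hj2 Hs') as [[C1 C2] _].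
      destruct (coef_m1 c e j s Hc He1 Hj2 Hs') as [[C3 C4] C5].
      apply Rabs_le_between in C5.
      pose proof (pw_le_1 s Hs') as HA1.
      pose proof (rad_pos e He s) as HS. pose proof (rho_pos e He s) as Hr.
      pose proof (pw_pos e g s) as HA.
      destruct (rho_bounds e He s (proj1 Hs')) as [[Hr1 _] [Hr2 [Hr3 _]]].
      set (S := rad e s) in *. set (r := rho e s) in *. set (A := pw e g s) in *.
      assert (HX : A / r <= A / S).
      { apply Rmult_le_compat_l; [lra|]. apply Rinv_le_contravar; lra. }
      assert (HX0 : 0 < A / r) by (apply Rdiv_lt_0_compat; auto).
      assert (HrX : r * (A / r) = A) by (field; lra).
      set (X := A / r) in *.
      (* the variation 9 s of the coefficient compensates the factor 1 / rho *)
      assert (HsX : s * X <= 501 / 1000) by nra.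
      assert (HeX : e ^ 2 * X <= 1 / 100).
      { assert (e * X <= A) by nra. assert (e * (e * X) <= e * A) by nra. nra. }
      assert (Hbeta : forall a x, 0 <= a <= 4 * c -> a <= c * (1 + 9 * s + 9 / 4 * e ^ 2) ->
                Rabs x <= Q + k1 * X -> Rabs (a * x) <= 4 / 10 * Q + 5 * (g * K) + g * K * X).
      { intros a x Ha Ha2 Hx. rewrite Rabs_mult, (Rabs_pos_eq a) by lra.
        apply Rle_trans with (a * (Q + k1 * X)); [apply Rmult_le_compat_l; lra|].
        assert (a * Q <= 4 / 10 * Q) by nra.
        assert (0 <= k1 * X) by nra.
        assert (a * (k1 * X) <= c * (1 + 9 * s + 9 / 4 * e ^ 2) * (k1 * X))
          by (apply Rmult_le_compat_r; auto).
        replace (c * (1 + 9 * s + 9 / 4 * e ^ 2) * (k1 * X))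
          with ((c * k1) * (X + 9 * (s * X) + 9 / 4 * (e ^ 2 * X))) in * by ring.
        rewrite Hck1 in *. nra. }
      unfold dphi, m. fold S A.
      pose proof (tail_slope c e j y Hc He1 Hj2 s B (4 / 10 * Q + 5 * (g * K) + g * K * X) l
        Hs' (fun k Hk => HB k s Hk Hs')) as HT1.
      assert (c * B <= 1 / 10 * B) by nra.
      assert (g * K * X <= K * (g * A / S)).
      { replace (K * (g * A / S)) with (g * K * (A / S)) by (field; lra).
        apply Rmult_le_compat_l; lra. }
      assert (0 <= c * (9 * s + 9 / 4 * e ^ 2)) by (apply Rmult_le_pos; nra).
      assert (c * (6 * (1 - j) * s + 9 / 4 * e ^ 2) <= c * (9 * s + 9 / 4 * e ^ 2))
        by (apply Rmult_le_compat_l; nra).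
      eapply Rle_trans; [apply HT1; auto; apply Hbeta; auto; lra |]. lra. }
  assert (Hphi : phi (half_time j) - phi t <= 1 / 2 * m + 1001 / 1000 * K).
  { unfold phi. pose proof (pw_le_1 (half_time j) ltac:(lra)).
    pose proof (pw_pos e g t). assert (0 <= m) by (unfold m; lra).
    assert (m * (half_time j - t) <= m * (1 / 2)) by (apply Rmult_le_compat_l; lra).
    assert (0 <= K * pw e g t) by nra. nra. }
  pose proof (Hend l). unfold m, Q in Hphi. split_Rabs; lra.
Qed.

(** Bernoulli's inequality makes rho^(-g) at most 1 + g / rho, so that dividing by the weight costs only a
    small constant wherever a factor t or rad is present. *)
Lemma inv_pw_bounds t : 0 <= t <= half_time j ->
  / pw e g t <= 1 + g / rho e t /\ t / pw e g t <= t + g / 2 /\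
  rad e t / pw e g t <= 53 / 100 /\ e ^ 2 / pw e g t <= 2 * e.
Proof.
  intros Ht. pose proof inward_time as HT.
  pose proof (inv_pw_le e He g t ltac:(lra)) as H.
  pose proof (rad_pos e He t). pose proof (rho_pos e He t).
  destruct (rad_bounds e He t (proj1 Ht)) as [_ [_ HS]].
  destruct (rho_bounds e He t (proj1 Ht)) as [[Hr1 _] [Hr2 [Hr3 _]]].
  assert (HI : / pw e g t <= 1 + g / rho e t) by (unfold Rdiv; lra).
  assert (Hq : rho e t * (g / rho e t) = g) by (field; lra).
  assert (0 <= g / rho e t) by (apply Rdiv_le_0_compat; lra).
  set (q := g / rho e t) in *. set (iA := / pw e g t) in *. unfold Rdiv. fold iA.
  repeat split; auto.
  - assert (t * iA <= t * (1 + q)) by (apply Rmult_le_compat_l; lra). nra.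
  - assert (rad e t * iA <= rad e t * (1 + q)) by (apply Rmult_le_compat_l; lra). nra.
  - assert (e ^ 2 * iA <= e ^ 2 * (1 + q)) by (apply Rmult_le_compat_l; nra).
    assert (e * q <= g) by nra. nra.
Qed.

(** In the model system f' = c v, v' = - 2 c f / rad^2 the combination (1 - g) f - c rad v picks the
    component proportional to rho^g, which dominates on arrival at the resonance; dividing by the
    weight makes it nearly constant. *)
Definition decaying (t : R) : R :=
  ((1 - g) * y 0%Z t - c * rad e t * (y (-1)%Z t - y 1%Z t)) / pw e g t.

Lemma continuous_decaying t : 0 <= t <= half_time j -> continuous decaying t.
Proof.
  intros Ht. pose proof (hf_cont _ _ _ _ Hy) as Hcont.
  apply (continuous_mult (K := R_AbsRing)).
  - apply (continuous_minus (K := R_AbsRing) (V := R_NormedModule)).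
    + apply (continuous_scal_r (K := R_AbsRing) (V := R_NormedModule)). auto.
    + apply (continuous_mult (K := R_AbsRing)).
      * apply (continuous_scal_r (K := R_AbsRing) (V := R_NormedModule)).
        apply (ex_derive_continuous (V := R_NormedModule)).
        eexists. apply (is_derive_rad e He).
      * apply (continuous_minus (K := R_AbsRing) (V := R_NormedModule)); auto.
  - apply (ex_derive_continuous (V := R_NormedModule)).
    apply (ex_derive_inv (fun t => pw e g t)).
    + eexists. apply (is_derive_pw e He).
    + apply Rgt_not_eq, pw_pos.
Qed.

(** The terms in f cancel because g (1 - g) = 2 c^2. What remains is the cut-off correction, the
    variation of the neighbouring coefficients, and the tail. *)
Lemma is_derive_decaying t : 0 < t < half_time j ->
  is_derive decaying t
    (c * (y (-1)%Z t - y 1%Z t) * (e ^ 2 / (rad e t * rho e t)) / pw e g t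
     + (1 - g) * ((acoef c e j (-1) t - c) * y (-1)%Z t
                  - (acoef c e j 1 t - c) * y 1%Z t) / pw e g t
     - c * (rad e t / pw e g t) * (acoef c e j (-2) t * y (-2)%Z t
                                   + acoef c e j 2 t * y 2%Z t)).
Proof.
  intros Ht.
  pose proof (derive_resonant c e j y Hy t Ht) as D0.
  pose proof (derive_p1 c e j y Hy t Ht) as D1.
  pose proof (derive_m1 c e j y Hy t Ht) as Dm1.
  rewrite coef_0 in D1, Dm1 by lra.
  pose proof (rad_pos e He t) as HS. pose proof (rho_pos e He t) as Hr.
  pose proof (pw_pos e g t) as HA.
  pose proof (rad_sub_rho e t) as HE.
  unfold decaying.
  auto_derive.
  - repeat split; try (eexists; eassumption).
    + eexists. apply (is_derive_rad e He).
    + eexists. apply (is_derive_pw e He).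
    + apply Rgt_not_eq, pw_pos.
  - rewrite_derivatives He D0 D1 Dm1.
    replace (e ^ 2 / (rad e t * rho e t)) with ((rad e t - t) / rad e t)
      by (rewrite <- HE; field; lra).
    match goal with |- ?l = ?r =>
      assert (Hid : l - r = y 0%Z t / (rad e t * pw e g t) * (2 * c ^ 2 - g * (1 - g)))
    end.
    { field. lra. }
    rewrite Hcg in Hid. lra.
Qed.

(** The three error terms of the derivative are integrated exactly. The constants have to stay well below
    the initial value 0.389 of inward_end, which is where c < 1/10 is used. *)
Lemma inward_drift t : 0 <= t <= half_time j ->
  Rabs (decaying (half_time j) - decaying t)
    <= 11 / 100 * Q + 62 / 1000 * K + 33 / 10000 * B.
Proof.
  intros Ht. pose proof inward_time as HT. pose proof inward_B_nonneg as HB0.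
  destruct (near_gain_bounds K HK) as [Hk1 [Hck1 Hk1']]. fold k1 in Hk1, Hck1, Hk1'.
  assert (HgK : 0 <= g * K <= 41 / 2000 * K) by nra.
  assert (HQ : 0 <= Q) by (unfold Q; lra).
  set (m := 4 * (1 - j) * g * Q + 9 * e * Q + 4 * (1 - j) * k1 + 9 / 2 * e * k1).
  set (phi := fun s : R => c * (4 * (1 - j) * Q * s ^ 2 + m * s) + 64 / 10000 * B * s
     - 2 * c * Q * (e ^ 2 / (rho e s * pw e g s)) - g * K * (e ^ 2 / (rho e s * rho e s))).
  set (dphi := fun s : R => c * (8 * (1 - j) * Q * s + m) + 64 / 10000 * B
     + 2 * c * Q * (1 + g) * (e ^ 2 / (rad e s * rho e s)) / pw e g s
     + 2 * (g * K) * (e ^ 2 / (rad e s * rho e s)) / rho e s).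
  assert (Rabs (decaying (half_time j) - decaying t) <= phi (half_time j) - phi t) as Hinc.
  { apply (increment_abs_le _ _ (fun t => 
      (c * (y (-1)%Z t - y 1%Z t) * (e ^ 2 / (rad e t * rho e t)) / pw e g t
     + (1 - g) * ((acoef c e j (-1) t - c) * y (-1)%Z t
                  - (acoef c e j 1 t - c) * y 1%Z t) / pw e g t
     - c * (rad e t / pw e g t) * (acoef c e j (-2) t * y (-2)%Z t
                                   + acoef c e j 2 t * y 2%Z t))) dphi).
    - lra.
    - intros s Hs. apply continuous_decaying. lra.
    - intros s Hs. unfold phi, dphi. pose proof (rad_pos e He s).
      pose proof (rho_pos e He s). pose proof (pw_pos e g s).
      wderive He. field. lra.
    - intros s Hs. apply is_derive_decaying. lra.
    - intros s Hs. assert (Hs' : 0 <= s <= half_time j) by lra.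
      destruct (inward_near s Hs') as [N1 Nm1].
      destruct (coef_p1 c e j s Hc He1 Hj2 Hs') as [_ C2].
      destruct (coef_m1 c e j s Hc He1 Hj2 Hs') as [_ C5].
      destruct (inv_pw_bounds s Hs') as [I1 [I2 [I3 I4]]].
      pose proof (rad_pos e He s) as HS. pose proof (rho_pos e He s) as Hr.
      pose proof (pw_pos e g s) as HA.
      destruct (rho_bounds e He s (proj1 Hs')) as [[Hr1 _] [Hr2 [Hr3 _]]].
      assert (F2 : Rabs (acoef c e j (-2) s * y (-2)%Z s + acoef c e j 2 s * y 2%Z s)
                   <= 12 / 100 * B).
      { eapply Rle_trans; [apply Rabs_add_le; apply (far_term c e j y Hc He1 Hj2 s B);
          auto; lia|]. nra. }
      unfold dphi.
      set (S := rad e s) in *. set (r := rho e s) in *. set (A := pw e g s) in *.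
      set (D := e ^ 2 / (S * r)) in *.
      assert (HD : 0 < D) by (apply Rdiv_lt_0_compat; nra).
      assert (HN : forall a x y0 : R, 0 <= a -> Rabs x <= a -> Rabs y0 <= Q + k1 * (A / r) ->
                Rabs (x * y0) <= a * (Q + k1 * (A / r))).
      { intros a x y0 Ha Hx Hy0. apply Rabs_mul_le; auto. }
      eapply Rle_trans.
      + apply Rabs_sub_le; [apply Rabs_add_le|].
        * unfold Rdiv. apply Rabs_mul_le; [apply Rabs_mul_le; [apply Rabs_mul_le|]|].
          -- rewrite Rabs_pos_eq by lra. apply Rle_refl.
          -- apply Rabs_sub_le; eassumption.
          -- rewrite Rabs_pos_eq by lra. apply Rle_refl.
          -- rewrite Rabs_pos_eq by (apply Rlt_le, Rinv_0_lt_compat; lra). apply Rle_refl.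
        * unfold Rdiv at 1. apply Rabs_mul_le; [apply Rabs_mul_le; [|apply Rabs_sub_le; apply HN]|].
          -- rewrite Rabs_pos_eq by lra. apply Rle_refl.
          -- eapply Rle_trans; [apply Rabs_pos | exact C5].
          -- exact C5.
          -- exact Nm1.
          -- eapply Rle_trans; [apply Rabs_pos | exact C2].
          -- exact C2.
          -- exact N1.
          -- rewrite Rabs_pos_eq by (apply Rlt_le, Rinv_0_lt_compat; lra). apply Rle_refl.
        * apply Rabs_mul_le; [apply Rabs_mul_le|exact F2].
          -- rewrite Rabs_pos_eq by lra. apply Rle_refl.
          -- rewrite Rabs_pos_eq by (apply Rlt_le, Rdiv_lt_0_compat; auto). exact I3.
      + fold A.
        assert (T3 : c * (53 / 100) * (12 / 100 * B) <= 64 / 10000 * B) by nra.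
        assert (T1 : c * (Q + k1 * (A / r) + (Q + k1 * (A / r))) * D * / A
                 <= 2 * c * Q * (1 + g) * D / A + 2 * (g * K) * D / r).
        { replace (c * (Q + k1 * (A / r) + (Q + k1 * (A / r))) * D * / A)
            with (2 * c * Q * D / A + 2 * (c * k1) * D / r) by (field; lra).
          rewrite Hck1.
          assert (0 <= 2 * c * Q * D / A) by (apply Rdiv_le_0_compat; auto; 
            apply Rmult_le_pos; [apply Rmult_le_pos|]; lra).
          replace (2 * c * Q * (1 + g) * D / A) with (2 * c * Q * D / A * (1 + g))
            by (field; lra). nra. }
        assert (Hsr : s / r <= 1 / 2) by (apply div_le; lra).
        assert (Her : e ^ 2 / r <= e) by (apply div_le; nra).
        assert (Hq0 : 0 <= c * Q) by (apply Rmult_le_pos; lra).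
        assert (Hq1 : 0 <= c * k1) by (apply Rmult_le_pos; lra).
        assert (T2 : (1 - g) * (c * (6 * (1 - j) * s + 9 / 4 * e ^ 2) * (Q + k1 * (A / r))
                      + c * (2 * (1 + j) * s + 9 / 4 * e ^ 2) * (Q + k1 * (A / r))) * / A
                 <= c * (8 * (1 - j) * Q * s + m)).
        { replace ((1 - g) * (c * (6 * (1 - j) * s + 9 / 4 * e ^ 2) * (Q + k1 * (A / r))
                      + c * (2 * (1 + j) * s + 9 / 4 * e ^ 2) * (Q + k1 * (A / r))) * / A)
            with ((1 - g) * (c * Q * ((8 - 4 * j) * (s / A) + 9 / 2 * (e ^ 2 / A))
                   + c * k1 * ((8 - 4 * j) * (s / r) + 9 / 2 * (e ^ 2 / r))))
            by (field; lra).
          assert (0 <= s / A) by (apply Rdiv_le_0_compat; lra).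
          assert (0 <= s / r) by (apply Rdiv_le_0_compat; lra).
          assert (0 <= e ^ 2 / A) by (apply Rdiv_le_0_compat; nra).
          assert (0 <= e ^ 2 / r) by (apply Rdiv_le_0_compat; nra).
          assert (U1 : (8 - 4 * j) * (s / A) + 9 / 2 * (e ^ 2 / A)
                    <= 8 * (1 - j) * (s + g / 2) + 9 * e) by nra.
          assert (U2 : (8 - 4 * j) * (s / r) + 9 / 2 * (e ^ 2 / r)
                    <= 4 * (1 - j) + 9 / 2 * e) by nra.
          assert (V1 := Rmult_le_compat_l _ _ _ Hq0 U1).
          assert (V2 := Rmult_le_compat_l _ _ _ Hq1 U2).
          set (X := c * Q * ((8 - 4 * j) * (s / A) + 9 / 2 * (e ^ 2 / A))
                    + c * k1 * ((8 - 4 * j) * (s / r) + 9 / 2 * (e ^ 2 / r))) in *.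
          assert (0 <= X).
          { unfold X. apply Rplus_le_le_0_compat; apply Rmult_le_pos; auto; nra. }
          apply Rle_trans with X; [nra|].
          replace (c * (8 * (1 - j) * Q * s + m)) with
            (c * Q * (8 * (1 - j) * (s + g / 2) + 9 * e) + c * k1 * (4 * (1 - j) + 9 / 2 * e))
            by (unfold m; field).
          unfold X. lra. }
        lra. }
  assert (Hphi : phi (half_time j) - phi t
                 <= 11 / 100 * Q + 62 / 1000 * K + 33 / 10000 * B).
  { unfold phi. set (T := half_time j) in *.
    assert (HjT : (1 - j) * T = 1 / 2) by (unfold T, half_time; field; lra).
    pose proof (rho_pos e He t) as Hr. pose proof (pw_pos e g t) as HA.
    destruct (rho_bounds e He t (proj1 Ht)) as [_ [Hr2 _]].
    destruct (inv_pw_bounds t Ht) as [I1 _].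
    assert (0 < e ^ 2 / (rho e T * pw e g T)).
    { apply Rdiv_lt_0_compat; [nra|]. apply Rmult_lt_0_compat;
        [apply rho_pos, He | apply pw_pos]. }
    assert (0 < e ^ 2 / (rho e T * rho e T)).
    { apply Rdiv_lt_0_compat; [nra|]. apply Rmult_lt_0_compat; apply rho_pos, He. }
    assert (W1 : e ^ 2 / (rho e t * rho e t) <= 1) by (apply div_le; nra).
    assert (W2 : e ^ 2 / (rho e t * pw e g t) <= e + g).
    { replace (e ^ 2 / (rho e t * pw e g t)) with (e ^ 2 / rho e t * / pw e g t)
        by (field; lra).
      assert (0 <= e ^ 2 / rho e t <= e).
      { split; [apply Rdiv_le_0_compat; nra | apply div_le; nra]. }
      apply Rle_trans with (e ^ 2 / rho e t * (1 + g / rho e t)).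
      - apply Rmult_le_compat_l; lra.
      - replace (e ^ 2 / rho e t * (1 + g / rho e t))
          with (e ^ 2 / rho e t + g * (e ^ 2 / (rho e t * rho e t))) by (field; lra).
        nra. }
    assert (Hm : 0 <= m).
    { assert (0 <= (1 - j) * Q) by (apply Rmult_le_pos; lra).
      assert (0 <= (1 - j) * Q * g) by (apply Rmult_le_pos; lra).
      assert (0 <= e * Q) by (apply Rmult_le_pos; lra).
      assert (0 <= (1 - j) * k1) by (apply Rmult_le_pos; lra).
      assert (0 <= e * k1) by (apply Rmult_le_pos; lra).
      unfold m. lra. }
    assert (HcQ : 0 <= c * Q <= 1 / 10 * Q) by nra.
    assert (Hcm : c * (4 * (1 - j) * Q * T ^ 2 + m * T)
              <= 1 / 10 * Q * (1 + 2 * g + 9 * e) + 2 * (g * K) + 9 / 2 * e * (g * K)).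
    { replace (c * (4 * (1 - j) * Q * T ^ 2 + m * T)) with
        (c * Q * (4 * ((1 - j) * T) * T + 4 * ((1 - j) * T) * g + 9 * e * T)
          + c * k1 * (4 * ((1 - j) * T)) + 9 / 2 * e * (c * k1) * T) by (unfold m; ring).
      rewrite HjT, Hck1.
      assert (c * Q * (4 * (1 / 2) * T + 4 * (1 / 2) * g + 9 * e * T)
              <= 1 / 10 * Q * (1 + 2 * g + 9 * e)).
      { apply Rmult_le_compat; nra. }
      assert (0 <= e * (g * K)) by (apply Rmult_le_pos; lra). nra. }
    assert (0 <= c * (4 * (1 - j) * Q * t ^ 2 + m * t)).
    { apply Rmult_le_pos; [lra|]. apply Rplus_le_le_0_compat.
      - repeat apply Rmult_le_pos; try lra; nra.
      - apply Rmult_le_pos; lra. }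
    assert (2 * c * Q * (e ^ 2 / (rho e t * pw e g t)) <= 2 / 10 * Q * (e + g)).
    { apply Rmult_le_compat; try nra. apply Rdiv_le_0_compat; nra. }
    assert (g * K * (e ^ 2 / (rho e t * rho e t)) <= g * K * 1)
      by (apply Rmult_le_compat_l; lra).
    assert (0 <= c * Q * (e ^ 2 / (rho e T * pw e g T))) by (apply Rmult_le_pos; lra).
    assert (0 <= g * K * (e ^ 2 / (rho e T * rho e T))) by (apply Rmult_le_pos; lra).
    assert (0 <= B * t) by (apply Rmult_le_pos; lra).
    assert (B * T <= B * (1 / 2)) by (apply Rmult_le_compat_l; lra).
    assert (e * (g * K) <= 1 / 1000000 * (g * K)) by (apply Rmult_le_compat_r; lra).
    assert (Q * e <= Q * (1 / 1000000)) by (apply Rmult_le_compat_l; lra).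
    assert (Q * g <= Q * (41 / 2000)) by (apply Rmult_le_compat_l; lra).
    lra. }
  lra.
Qed.

Lemma inward_jump t : 0 <= t <= half_time j ->
  Rabs (c * rad e t * (y (-1)%Z t - y 1%Z t))
    <= 2 / 10 * Q * rad e t + 41 / 1000 * K * pw e g t.
Proof.
  intros Ht. pose proof inward_B_nonneg as HB0.
  destruct (near_gain_bounds K HK) as [Hk1 [Hck1 _]]. fold k1 in Hk1, Hck1.
  destruct (inward_near t Ht) as [N1 Nm1].
  pose proof (rad_pos e He t) as HS. pose proof (rho_pos e He t) as Hr.
  pose proof (pw_pos e g t) as HA.
  destruct (rho_bounds e He t (proj1 Ht)) as [[Hr1 _] _].
  eapply Rle_trans; [apply Rabs_mul_le|].
  - rewrite Rabs_pos_eq by nra. apply Rle_refl.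
  - apply Rabs_sub_le; eassumption.
  - replace (c * rad e t * (Q + k1 * (pw e g t / rho e t) + (Q + k1 * (pw e g t / rho e t))))
      with (2 * c * (Q * rad e t) + 2 * (c * k1) * (rad e t / rho e t) * pw e g t)
      by (field; lra).
    rewrite Hck1.
    assert (HQS : 0 <= Q * rad e t) by (apply Rmult_le_pos; unfold Q; lra).
    assert (Hq : rad e t / rho e t <= 1) by (apply div_le; lra).
    assert (0 <= g * K <= 41 / 2000 * K) by nra.
    assert (g * K * (rad e t / rho e t) <= 41 / 2000 * K) by nra.
    nra.
Qed.

Lemma inward_end :
  Rabs (decaying (half_time j)) <= 1112 / 1000 /\
  (1 / 2 <= y 0%Z (half_time j) -> 389 / 1000 <= decaying (half_time j)).
Proof.
  pose proof inward_time as HT. set (T := half_time j) in *.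
  assert (HTT : 0 <= T <= half_time j) by (unfold T in *; lra).
  pose proof (rad_pos e He T) as HS. pose proof (rho_pos e He T) as Hr.
  pose proof (pw_pos e g T) as HA. pose proof (pw_le_1 T HTT) as HA1.
  destruct (rad_bounds e He T (proj1 HTT)) as [_ HS1].
  destruct (rho_bounds e He T (proj1 HTT)) as [_ [_ Hr2]].
  pose proof (inv_pw_le e He g T ltac:(lra)) as HI.
  assert (HI2 : / pw e g T <= 10103 / 10000).
  { assert (/ rho e T <= 3 / 2).
    { replace (3 / 2) with (/ (2 / 3)) by field. apply Rinv_le_contravar; lra. }
    nra. }
  assert (HI0 : 0 < / pw e g T) by (apply Rinv_0_lt_compat; auto).
  pose proof (Hend 0%Z) as E0. pose proof (Hend 1%Z) as E1. pose proof (Hend (-1)%Z) as Em1.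
  fold T in E0, E1, Em1.
  assert (J : Rabs (c * rad e T * (y (-1)%Z T - y 1%Z T)) <= 1 / 10 * (51 / 100) * 2).
  { apply Rle_trans with (c * rad e T * (1 + 1)).
    - apply Rabs_mul_le; [rewrite Rabs_pos_eq by nra; lra|]. apply Rabs_sub_le; auto.
    - nra. }
  assert (J' : Rabs (c * rad e T * (y (-1)%Z T - y 1%Z T)) <= 1 / 10 * (1 / 2 + e) * 2).
  { apply Rle_trans with (c * rad e T * (1 + 1)).
    - apply Rabs_mul_le; [rewrite Rabs_pos_eq by nra; lra|]. apply Rabs_sub_le; auto.
    - nra. }
  unfold decaying. fold T. split.
  - unfold Rdiv. apply Rle_trans with ((1 + 1 / 10 * (1 / 2 + e) * 2) * (10103 / 10000)).
    + apply Rabs_mul_le.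
      * apply Rabs_sub_le; auto. rewrite <- (Rmult_1_r 1). apply Rabs_mul_le; auto.
        rewrite Rabs_pos_eq; lra.
      * rewrite Rabs_pos_eq; lra.
    + lra.
  - intros Hhalf. apply le_div; auto.
    apply Rabs_le_between in J'. nra.
Qed.

Lemma inward_gain t : 0 <= t <= half_time j ->
  (1 - g) * Rabs (y 0%Z t) <=
    (1112 / 1000 + 216 / 1000 * Q + 103 / 1000 * K + 33 / 10000 * B) * pw e g t.
Proof.
  intros Ht. pose proof inward_B_nonneg as HB0.
  pose proof (inward_jump t Ht) as HJ. pose proof (inward_drift t Ht) as HD.
  destruct inward_end as [HE _].
  pose proof (pw_pos e g t) as HA.
  destruct (inv_pw_bounds t Ht) as [_ [_ [IS _]]].
  assert (HS : rad e t <= 53 / 100 * pw e g t).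
  { replace (rad e t) with (rad e t / pw e g t * pw e g t) by (field; lra).
    apply Rmult_le_compat_r; lra. }
  assert (HF : Rabs (decaying t) <= 1112 / 1000 + (11 / 100 * Q + 62 / 1000 * K + 33 / 10000 * B)).
  { replace (decaying t) with
      (decaying (half_time j) - (decaying (half_time j) - decaying t)) by ring.
    apply Rabs_sub_le; auto. }
  replace ((1 - g) * Rabs (y 0%Z t)) with (Rabs ((1 - g) * y 0%Z t))
    by (rewrite Rabs_mult, (Rabs_pos_eq (1 - g)); lra).
  replace ((1 - g) * y 0%Z t) with
    (decaying t * pw e g t + c * rad e t * (y (-1)%Z t - y 1%Z t))
    by (unfold decaying; field; lra).
  eapply Rle_trans; [apply Rabs_add_le; [apply Rabs_mul_le; [exact HF|]|exact HJ]|].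
  - rewrite Rabs_pos_eq; [apply Rle_refl|lra].
  - assert (Q * rad e t <= Q * (53 / 100 * pw e g t))
      by (apply Rmult_le_compat_l; unfold Q; lra).
    lra.
Qed.

End Given.

Lemma inward_tail_of_gain K : 0 <= K ->
  (forall t, 0 <= t <= half_time j -> Rabs (y 0%Z t) <= K * pw e g t) ->
  forall l t, (2 <= Z.abs l)%Z -> 0 <= t <= half_time j ->
    Rabs (y l t) <= 131 / 100 + 119 / 100 * K.
Proof.
  intros HK Hf l t Hl Ht.
  destruct (hf_bdd _ _ _ _ Hy) as [M HM].
  apply Rle_trans with ((121 / 100 + 11 / 10 * K) / (1 - 7 / 100)); [|lra].
  apply (self_improving_bound (Z * R)
    (fun p => (2 <= Z.abs (fst p))%Z /\ 0 <= snd p <= half_time j)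
    (fun p => Rabs (y (fst p) (snd p)))) with (i := (l, t)); simpl; try lra; auto.
  - exists M. intros [k s] [Hk Hs]. apply HM; auto.
  - intros B HB0 HB [k s] [Hk Hs]. simpl.
    apply inward_tail with (B := B); auto.
    intros k' s' Hk' Hs'. apply (HB (k', s')); auto.
Qed.

(** The bound on f in terms of the bounds for f and for the tail has factor 0.12, so it closes. *)
Lemma inward_resonant_bound t : 0 <= t <= half_time j ->
  Rabs (y 0%Z t) <= 156 / 100 * pw e g t.
Proof.
  intros Ht. pose proof (pw_pos e g t) as HA.
  destruct (hf_bdd _ _ _ _ Hy) as [M HM].
  assert (Hpos : forall s, 0 < pw e g s) by (intros; apply pw_pos).
  assert (H : Rabs (y 0%Z t) / pw e g t <= 137 / 100 / (1 - 12 / 100)).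
  { apply (self_improving_bound R (fun s => 0 <= s <= half_time j)
      (fun s => Rabs (y 0%Z s) / pw e g s)) with (i := t); try lra; auto.
    - exists (M * (1 + g / e)). intros s Hs.
      destruct (inv_pw_bounds s Hs) as [I1 _].
      destruct (rho_bounds e He s (proj1 Hs)) as [_ [Hr2 _]].
      apply Rmult_le_compat; auto using Rabs_pos.
      + apply Rlt_le, Rinv_0_lt_compat; auto.
      + apply Rle_trans with (1 := I1). apply Rplus_le_compat_l.
        apply Rmult_le_compat_l; [lra|]. apply Rinv_le_contravar; lra.
    - intros K HK HKb s Hs.
      assert (Hf : forall t, 0 <= t <= half_time j -> Rabs (y 0%Z t) <= K * pw e g t).
      { intros r Hr. replace (Rabs (y 0%Z r)) with (Rabs (y 0%Z r) / pw e g r * pw e g r)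
          by (field; apply Rgt_not_eq, Hpos).
        apply Rmult_le_compat_r; auto. apply Rlt_le, Hpos. }
      pose proof (inward_gain K _ HK Hf (inward_tail_of_gain K HK Hf) s Hs) as HG.
      apply div_le; auto. specialize (Hpos s).
      set (A := pw e g s) in *. set (Y := Rabs (y 0%Z s)) in *.
      assert (0 <= Y) by apply Rabs_pos.
      assert (0 <= K * A) by (apply Rmult_le_pos; lra).
      assert ((1 - 41 / 2000) * Y <= (1 - g) * Y) by (apply Rmult_le_compat_r; lra).
      lra. }
  replace (Rabs (y 0%Z t)) with (Rabs (y 0%Z t) / pw e g t * pw e g t) by (field; lra).
  apply Rmult_le_compat_r; lra.
Qed.

(** At the resonance the resonant mode has size e^g and the difference of its neighbours e^(g-1), while
    the sum of the neighbours and the tail stay bounded. The lower bound propagates through decaying;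
    the sign condition on the difference holds up to an error e^(-1/2), far below e^(g-1), since on
    the way from half_time j to 0 a positive f can only increase this difference. *)
Lemma inward_conclusion :
  Rabs (y 0%Z 0) <= 16 / 10 * pw e g 0 /\
  Rabs (y (-1)%Z 0 - y 1%Z 0) <= 3 * (pw e g 0 / e) /\
  Rabs (y (-1)%Z 0 + y 1%Z 0) <= 3 /\
  (forall l, (2 <= Z.abs l)%Z -> Rabs (y l 0) <= 4) /\
  (1 / 2 <= y 0%Z (half_time j) ->
     8 / 100 * pw e g 0 <= y 0%Z 0 /\
     - (3 / sqrt e) <= y (-1)%Z 0 - y 1%Z 0).
Proof.
  pose proof inward_time as HT.
  assert (H0 : 0 <= 0 <= half_time j) by lra.
  pose proof inward_resonant_bound as Hf.
  pose proof (inward_tail_of_gain (156 / 100) ltac:(lra) Hf) as HB.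
  pose proof (inward_near (156 / 100) _ ltac:(lra) Hf HB) as HN.
  pose proof (pw_pos e g 0) as HA.
  destruct (near_gain_bounds (156 / 100) ltac:(lra)) as [Hk1 [_ Hk1']].
  destruct (sqrt_small e He ltac:(lra)) as [Hh Hh0].
  assert (Hh1 : sqrt e <= 1 / 1000).
  { rewrite <- (Rinv_inv (sqrt e)). replace (1 / 1000) with (/ 1000) by field.
    apply Rinv_le_contravar; lra. }
  assert (Hee : sqrt e * sqrt e = e) by (apply sqrt_sqrt; lra).
  assert (Hae : 1 <= pw e g 0 / e).
  { apply le_div; auto. pose proof (sqrt_le_start e He g ltac:(lra) ltac:(lra)). nra. }
  assert (Hfar : forall l s, (2 <= Z.abs l)%Z -> 0 <= s <= half_time j ->
            Rabs (acoef c e j l s * y l s) <= 2 / 10).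
  { intros l s Hl Hs. 
    pose proof (far_term c e j y Hc He1 Hj2 s _ l Hs (fun k Hk => HB k s Hk Hs) Hl).
    nra. }
  split; [|split; [|split; [|split]]].
  - specialize (Hf 0 H0). lra.
  - destruct (HN 0 H0) as [N1 Nm1]. rewrite rho_0 in N1, Nm1 by auto.
    eapply Rle_trans; [apply Rabs_sub_le; eassumption|]. nra.
  - pose proof (side_sum_increment c e j y Hy (2 / 10) 0 (half_time j)
      ltac:(lra) ltac:(lra) Hfar).
    pose proof (Hend 1%Z). pose proof (Hend (-1)%Z). split_Rabs; lra.
  - intros l Hl. specialize (HB l 0 Hl H0). lra.
  - intros Hhalf.
    assert (Hlow : forall s, 0 <= s <= half_time j ->
              9 / 100 * pw e g s - 23 / 100 * rad e s <= y 0%Z s).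
    { intros s Hs.
      pose proof (inward_jump (156 / 100) _ ltac:(lra) Hf HB s Hs) as HJ.
      pose proof (inward_drift (156 / 100) _ ltac:(lra) Hf HB s Hs) as HD.
      destruct (inward_end) as [_ HE]. specialize (HE Hhalf).
      pose proof (pw_pos e g s) as HAs. pose proof (rad_pos e He s) as HS.
      apply Rabs_le_between in HJ. apply Rabs_le_between in HD.
      assert (HF : 16 / 100 <= decaying s) by lra.
      assert (HFA : 16 / 100 * pw e g s <= decaying s * pw e g s)
        by (apply Rmult_le_compat_r; lra).
      assert (Hid : (1 - g) * y 0%Z s =
        decaying s * pw e g s + c * rad e s * (y (-1)%Z s - y 1%Z s))
        by (unfold decaying; field; lra).
      assert (HY : 96 / 1000 * pw e g s - 22 / 100 * rad e s <= (1 - g) * y 0%Z s) by lra.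
      destruct (Rle_dec 0 (y 0%Z s)).
      - assert ((1 - g) * y 0%Z s <= y 0%Z s) by nra. lra.
      - assert ((1 - g) * y 0%Z s <= (1 - 41 / 2000) * y 0%Z s) by nra. lra. }
    split.
    + specialize (Hlow 0 H0). rewrite rad_0 in Hlow by auto.
      pose proof (sqrt_le_start e He g ltac:(lra) ltac:(lra)).
      nra.
    + assert (Dphi : forall s, is_derive (fun s => 4 / 10 * s - 1 / 10 / sqrt (rho e s)) s
          (4 / 10 + 1 / 20 / (sqrt (rho e s) * rad e s))).
      { intros s. pose proof (rad_pos e He s) as HS. pose proof (rho_pos e He s) as Hr.
        pose proof (sqrt_lt_R0 _ Hr) as Hq. pose proof (sqrt_sqrt _ (Rlt_le _ _ Hr)) as Hqq.
        wderive He. rewrite <- Hqq at 1. field. lra. }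
      assert ((y (-1)%Z (half_time j) - y 1%Z (half_time j)) - (y (-1)%Z 0 - y 1%Z 0)
        <= (4 / 10 * half_time j - 1 / 10 / sqrt (rho e (half_time j)))
           - (4 / 10 * 0 - 1 / 10 / sqrt (rho e 0))).
      { apply (increment_le (fun s => y (-1)%Z s - y 1%Z s)
          (fun s => 4 / 10 * s - 1 / 10 / sqrt (rho e s))
          (fun s => (acoef c e j (-2) s * y (-2)%Z s - acoef c e j 0 s * y 0%Z s)
                    - (acoef c e j 0 s * y 0%Z s - acoef c e j 2 s * y 2%Z s))
          (fun s => 4 / 10 + 1 / 20 / (sqrt (rho e s) * rad e s))).
        - lra.
        - intros s Hs. apply (continuous_minus (K := R_AbsRing) (V := R_NormedModule));
            apply (hf_cont _ _ _ _ Hy); lra.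
        - intros s Hs. apply (ex_derive_continuous (V := R_NormedModule)).
          eexists. apply Dphi.
        - intros s Hs. apply (is_derive_minus (K := R_AbsRing) (V := R_NormedModule)).
          + apply derive_m1; auto.
          + apply derive_p1; auto.
        - intros s Hs. apply Dphi.
        - intros s Hs. rewrite coef_0 by lra.
          assert (Hs' : 0 <= s <= half_time j) by lra.
          specialize (Hlow s Hs').
          pose proof (Hfar (-2)%Z s ltac:(lia) Hs') as F1.
          pose proof (Hfar 2%Z s ltac:(lia) Hs') as F2.
          apply Rabs_le_between in F1. apply Rabs_le_between in F2.
          pose proof (rad_pos e He s) as HS. pose proof (pw_pos e g s) as HAs.
          pose proof (rho_pos e He s) as Hr.
          destruct (rho_bounds e He s (proj1 Hs')) as [_ [_ Hr2]].
          pose proof (sqrt_lt_R0 _ Hr) as Hq.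
          assert (sqrt (rho e s) <= 101 / 100).
          { apply Rle_trans with (sqrt (1 + 1 / 1000000)); [apply sqrt_le_1; lra|].
            rewrite <- (sqrt_pow2 (101 / 100)) by lra. apply sqrt_le_1; lra. }
          assert (c / (rad e s * rad e s) * (- y 0%Z s) <= 1 / 40 / (sqrt (rho e s) * rad e s)).
          { apply Rle_trans with (c / (rad e s * rad e s) * (23 / 100 * rad e s)).
            - apply Rmult_le_compat_l; [apply Rdiv_le_0_compat; nra | lra].
            - replace (c / (rad e s * rad e s) * (23 / 100 * rad e s)) with
                (c * (23 / 100) / rad e s) by (field; lra).
              replace (1 / 40 / (sqrt (rho e s) * rad e s)) with
                (1 / 40 / sqrt (rho e s) / rad e s) by (field; lra).
              apply Rmult_le_compat_r; [apply Rlt_le, Rinv_0_lt_compat; auto|].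
              apply le_div; auto. nra. }
          replace (1 / 20 / (sqrt (rho e s) * rad e s)) with
            (2 * (1 / 40 / (sqrt (rho e s) * rad e s))) by (field; lra).
          lra. }
      rewrite rho_0 in H by auto.
      assert (0 < 1 / 10 / sqrt (rho e (half_time j))).
      { apply Rdiv_lt_0_compat; [lra|]. apply sqrt_lt_R0, rho_pos, He. }
      pose proof (Hend 1%Z) as E1. pose proof (Hend (-1)%Z) as Em1.
      apply Rabs_le_between in E1. apply Rabs_le_between in Em1.
      unfold Rdiv in *. lra.
Qed.

End Inward.

(** * Leaving the resonance *)

Section Outward.
Context (c e g j : R) (y : Z -> R -> R) (Hreg : regime c e g)
  (Hj : 0 <= j <= 1 / 2) (Hy : half_flow c e j y)
  (Hf0 : Rabs (y 0%Z 0) <= 16 / 10 * pw e g 0)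
  (Hv0 : Rabs (y (-1)%Z 0 - y 1%Z 0) <= 3 * (pw e g 0 / e))
  (Hw0 : Rabs (y (-1)%Z 0 + y 1%Z 0) <= 3)
  (Hr0 : forall l, (2 <= Z.abs l)%Z -> Rabs (y l 0) <= 4).

Let Hc : 0 < c. Proof. apply Hreg. Qed.
Let Hc1 : c < 1 / 10. Proof. apply Hreg. Qed.
Let He : 0 < e. Proof. apply Hreg. Qed.
Let He1 : 0 < e <= 1 / 1000000. Proof. apply Hreg. Qed.
Let Hg : 0 < g <= 41 / 2000. Proof. apply Hreg. Qed.
Let Hcg : g * (1 - g) = 2 * c ^ 2. Proof. apply Hreg. Qed.
Let Hj2 : - (1 / 2) <= j <= 1 / 2. Proof. lra. Qed.

Lemma outward_time : 1 / 2 <= half_time j <= 1.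
Proof.
  unfold half_time. split.
  - apply Rle_trans with (/ 2); [lra|]. apply Rinv_le_contravar; lra.
  - apply Rle_trans with (/ 1); [|lra]. apply Rinv_le_contravar; lra.
Qed.

Lemma outward_weights t : 0 <= t <= half_time j ->
  pw e g t <= 103 / 100 /\ t / pw e g t <= 1011 / 1000 /\
  t / sqrt (rho e t) <= 71 / 100 /\ 7 / 10 <= pw e g t / sqrt (rho e t).
Proof.
  intros Ht. pose proof outward_time as HT.
  pose proof (inv_pw_le e He g t ltac:(lra)) as HI.
  pose proof (pw_le e He g t ltac:(lra)) as HA1.
  pose proof (rho_pos e He t) as Hr. pose proof (pw_pos e g t) as HA.
  destruct (rho_bounds e He t (proj1 Ht)) as [_ [Hr2 [Hr3 Hr4]]].
  pose proof (sqrt_lt_R0 _ Hr) as Hq. pose proof (sqrt_sqrt _ (Rlt_le _ _ Hr)) as Hqq.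
  split; [nra|split; [|split]].
  - unfold Rdiv.
    assert (t * / pw e g t <= t * (1 + g * (/ rho e t - 1))) by (apply Rmult_le_compat_l; lra).
    assert (t * / rho e t <= 1 / 2) by (apply div_le; lra). nra.
  - apply div_le; auto. nra.
  - set (T := half_time j) in *.
    apply Rle_trans with (pw e g T / sqrt (rho e T)).
    + assert (1 <= pw e g T).
      { unfold pw. rewrite <- (Rpower_O (rho e T)) at 1 by (apply rho_pos; auto).
        destruct (rho_bounds e He T ltac:(lra)) as [_ [_ [? _]]].
        apply Rle_Rpower; lra. }
      pose proof (rho_pos e He T) as HrT.
      destruct (rho_bounds e He T ltac:(lra)) as [_ [_ [_ ?]]].
      pose proof (sqrt_lt_R0 _ HrT). pose proof (sqrt_sqrt _ (Rlt_le _ _ HrT)).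
      apply le_div; auto. nra.
    + rewrite <- !Rpower_sqrt by (apply rho_pos; auto).
      apply Rpower_ratio_le; [|lra]. split; [apply rho_pos; auto|].
      apply rho_incr; auto; lra.
Qed.

(** Monotonicity of rho^(g - 1/2), used to pull the value at the left end out of integrals. *)
Lemma pw_sqrt_ratio_le s t : 0 <= s <= t ->
  pw e g t / sqrt (rho e t) <= pw e g s / sqrt (rho e s).
Proof.
  intros H. rewrite <- !Rpower_sqrt by (apply rho_pos; auto).
  apply Rpower_ratio_le; [|lra]. split; [apply rho_pos; auto|].
  apply rho_incr; auto.
Qed.

Lemma pw_rho_ratio_le s t : 0 <= s <= t ->
  pw e g t / rho e t <= pw e g s / rho e s.
Proof.
  intros H. rewrite <- (Rpower_1 (rho e s)), <- (Rpower_1 (rho e t)) by (apply rho_pos; auto).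
  unfold pw. rewrite !Rpower_1 by (apply rho_pos; auto).
  rewrite <- (Rpower_1 (rho e s)) at 2 by (apply rho_pos; auto).
  rewrite <- (Rpower_1 (rho e t)) at 2 by (apply rho_pos; auto).
  apply Rpower_ratio_le; [|lra]. split; [apply rho_pos; auto|].
  apply rho_incr; auto.
Qed.

(** After the resonance the component proportional to rho^(1-g) dominates, and c rad v - g f picks it.
    Normalising by rad / rho^g rather than by rho^(1-g) removes v from the derivative: only f is left,
    against the integrable kernel e^2 / rad^3. *)
Definition growing (t : R) : R :=
  (c * rad e t * (y (-1)%Z t - y 1%Z t) - g * y 0%Z t) * (pw e g t / rad e t).

(** The bound assumed on v has a main part d rho^(-g) and a lower-order part E rho^(-1/2). Two weights are
    necessary because the value of growing at the end controls only the first one. *)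
Section Given.
Context (d E B : R) (Hd : 0 <= d) (HE : 0 <= E)
  (Hv : forall t, 0 <= t <= half_time j ->
     Rabs (y (-1)%Z t - y 1%Z t) <= d / pw e g t + E / sqrt (rho e t))
  (HB : forall l t, (2 <= Z.abs l)%Z -> 0 <= t <= half_time j -> Rabs (y l t) <= B).

Let W := 3 + 12 / 100 * B.
Let mass (t : R) : R := d / (1 - g) * (t / pw e g t) + 2 * E * (t / sqrt (rho e t)) + W * t.

Lemma outward_B_nonneg : 0 <= B.
Proof.
  pose proof outward_time.
  apply Rle_trans with (2 := HB 2%Z 0 ltac:(lia) ltac:(lra)). apply Rabs_pos.
Qed.

Lemma outward_far l t : (2 <= Z.abs l)%Z -> 0 <= t <= half_time j ->
  Rabs (acoef c e j l t * y l t) <= 6 / 100 * B.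
Proof.
  intros Hl Ht. pose proof outward_B_nonneg.
  pose proof (far_term c e j y Hc He1 Hj2 t B l Ht (fun k Hk => HB k t Hk Ht) Hl).
  nra.
Qed.

Lemma outward_sum t : 0 <= t <= half_time j -> Rabs (y (-1)%Z t + y 1%Z t) <= W.
Proof.
  intros Ht. pose proof outward_time as HT. pose proof outward_B_nonneg as HB0.
  pose proof (side_sum_increment c e j y Hy (6 / 100 * B) 0 t
    ltac:(lra) ltac:(lra) outward_far).
  assert (B * t <= B * 1) by (apply Rmult_le_compat_l; lra).
  unfold W. split_Rabs; lra.
Qed.

Lemma outward_near t : 0 <= t <= half_time j ->
  Rabs (y 1%Z t) <= (d / pw e g t + E / sqrt (rho e t) + W) / 2 /\
  Rabs (y (-1)%Z t) <= (d / pw e g t + E / sqrt (rho e t) + W) / 2.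
Proof.
  intros Ht. pose proof (outward_sum t Ht). pose proof (Hv t Ht). split_Rabs; lra.
Qed.

Lemma is_derive_mass t : is_derive mass t
  (d / (1 - g) * ((1 - g * (t / rad e t)) / pw e g t)
   + 2 * E * ((1 - t / rad e t / 2) / sqrt (rho e t)) + W).
Proof.
  pose proof (rad_pos e He t) as HS. pose proof (rho_pos e He t) as Hr.
  pose proof (pw_pos e g t) as HA.
  pose proof (sqrt_lt_R0 _ Hr) as Hq. pose proof (sqrt_sqrt _ (Rlt_le _ _ Hr)) as Hqq.
  unfold mass. wderive He. rewrite <- Hqq at 2. field. lra.
Qed.

(** The function mass is an antiderivative of a bound for |v| + W, where W bounds the sum of the two
    neighbours. Using t / rho^g, and not rho^(1-g),
    avoids a factor 2, because t <= rad. *)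
Lemma mass_slope t : 0 <= t <= half_time j ->
  d / pw e g t + E / sqrt (rho e t) + W <=
  d / (1 - g) * ((1 - g * (t / rad e t)) / pw e g t)
   + 2 * E * ((1 - t / rad e t / 2) / sqrt (rho e t)) + W.
Proof.
  intros Ht.
  pose proof (rad_pos e He t) as HS. pose proof (rho_pos e He t) as Hr.
  pose proof (pw_pos e g t) as HA. pose proof (sqrt_lt_R0 _ Hr) as Hq.
  destruct (rad_bounds e He t (proj1 Ht)) as [_ [HS1 _]].
  assert (0 <= t / rad e t <= 1).
  { split; [apply Rdiv_le_0_compat; lra | apply div_le; lra]. }
  set (x := t / rad e t) in *.
  assert (0 <= d / pw e g t) by (apply Rdiv_le_0_compat; lra).
  assert (0 <= E / sqrt (rho e t)) by (apply Rdiv_le_0_compat; lra).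
  apply Rplus_le_compat_r, Rplus_le_compat.
  - replace (d / (1 - g) * ((1 - g * x) / pw e g t)) with
      (d / pw e g t * ((1 - g * x) / (1 - g))) by (field; lra).
    rewrite <- (Rmult_1_r (d / pw e g t)) at 1. apply Rmult_le_compat_l; auto.
    apply le_div; nra.
  - replace (2 * E * ((1 - x / 2) / sqrt (rho e t))) with
      (E / sqrt (rho e t) * (2 - x)) by (field; lra).
    rewrite <- (Rmult_1_r (E / sqrt (rho e t))) at 1. apply Rmult_le_compat_l; lra.
Qed.

Lemma mass_0 : mass 0 = 0.
Proof. unfold mass, Rdiv. ring. Qed.

Lemma outward_tail l t : (2 <= Z.abs l)%Z -> 0 <= t <= half_time j ->
  Rabs (y l t) <= 4 + 12 / 100 * B + 2 / 10 * mass t.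
Proof.
  intros Hl Ht. pose proof outward_time as HT. pose proof outward_B_nonneg as HB0.
  assert (Rabs (y l t - y l 0) <= (12 / 100 * B * t + 2 / 10 * mass t)
             - (12 / 100 * B * 0 + 2 / 10 * mass 0)).
  { apply (increment_abs_le _ (fun s => 12 / 100 * B * s + 2 / 10 * mass s)
       (fun s => acoef c e j (l - 1) s * y (l - 1)%Z s
        - acoef c e j (l + 1) s * y (l + 1)%Z s)
       (fun s => 12 / 100 * B + 2 / 10 * (d / (1 - g) * ((1 - g * (s / rad e s)) / pw e g s)
           + 2 * E * ((1 - s / rad e s / 2) / sqrt (rho e s)) + W))).
    - lra.
    - intros s Hs. apply (hf_cont _ _ _ _ Hy); lra.
    - intros s Hs. auto_derive.
      + repeat split. eexists. apply is_derive_mass.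
      + rewrite (is_derive_unique (fun x : R => mass x) s _ (is_derive_mass s)). ring.
    - intros s Hs. apply (hf_der _ _ _ _ Hy); lra.
    - intros s Hs. assert (Hs' : 0 <= s <= half_time j) by lra.
      pose proof (mass_slope s Hs') as HM.
      destruct (outward_near s Hs') as [N1 Nm1].
      destruct (coef_p1 c e j s Hc He1 Hj2 Hs') as [[C1 C2] _].
      destruct (coef_m1 c e j s Hc He1 Hj2 Hs') as [[C3 C4] _].
      set (V := d / pw e g s + E / sqrt (rho e s) + W) in *.
      assert (Hbeta : forall a x, 0 <= a <= 4 * c -> Rabs x <= V / 2 ->
                Rabs (a * x) <= 2 / 10 * V).
      { intros a x Ha Hx. apply Rle_trans with (4 * c * (V / 2)).
        - apply Rabs_mul_le; auto. rewrite Rabs_pos_eq; lra.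
        - assert (0 <= V / 2) by (apply Rle_trans with (2 := Hx); apply Rabs_pos). nra. }
      pose proof (tail_slope c e j y Hc He1 Hj2 s B (2 / 10 * V) l
        Hs' (fun k Hk => HB k s Hk Hs')) as HT1.
      assert (c * B <= 1 / 10 * B) by nra.
      eapply Rle_trans; [apply HT1; auto; apply Hbeta; auto; lra|]. lra. }
  rewrite mass_0 in H. pose proof (Hr0 l Hl).
  assert (B * t <= B * 1) by (apply Rmult_le_compat_l; lra).
  split_Rabs; lra.
Qed.

Lemma outward_resonant t : 0 <= t <= half_time j ->
  Rabs (y 0%Z t - y 0%Z 0) <= 5 / 2 * c * mass t.
Proof.
  intros Ht.
  assert (Rabs (y 0%Z t - y 0%Z 0) <= 5 / 2 * c * mass t - 5 / 2 * c * mass 0).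
  { apply (increment_abs_le _ (fun s => 5 / 2 * c * mass s)
       (fun s => acoef c e j (-1) s * y (-1)%Z s - acoef c e j 1 s * y 1%Z s)
       (fun s => 5 / 2 * c * (d / (1 - g) * ((1 - g * (s / rad e s)) / pw e g s)
           + 2 * E * ((1 - s / rad e s / 2) / sqrt (rho e s)) + W))).
    - lra.
    - intros s Hs. apply (hf_cont _ _ _ _ Hy); lra.
    - intros s Hs. auto_derive.
      + repeat split. eexists. apply is_derive_mass.
      + rewrite (is_derive_unique (fun x : R => mass x) s _ (is_derive_mass s)). ring.
    - intros s Hs. apply derive_resonant; auto. lra.
    - intros s Hs. assert (Hs' : 0 <= s <= half_time j) by lra.
      pose proof (mass_slope s Hs') as HM.
      destruct (outward_near s Hs') as [N1 Nm1].
      destruct (coef_p1 c e j s Hc He1 Hj2 Hs') as [[C1 C2] _].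
      destruct (coef_m1 c e j s Hc He1 Hj2 Hs') as [[C3 C4] _].
      set (V := d / pw e g s + E / sqrt (rho e s) + W) in *.
      apply Rle_trans with (4 * c * (V / 2) + c * (V / 2)).
      + apply Rabs_sub_le; apply Rabs_mul_le; auto; rewrite Rabs_pos_eq; lra.
      + replace (4 * c * (V / 2) + c * (V / 2)) with (5 / 2 * c * V) by field.
        apply Rmult_le_compat_l; lra. }
  rewrite mass_0 in H. lra.
Qed.

Lemma continuous_growing t : 0 <= t <= half_time j -> continuous growing t.
Proof.
  intros Ht. pose proof (hf_cont _ _ _ _ Hy) as Hcont.
  pose proof (rad_pos e He t) as HS.
  apply (continuous_mult (K := R_AbsRing)).
  - apply (continuous_minus (K := R_AbsRing) (V := R_NormedModule)).
    + apply (continuous_mult (K := R_AbsRing)).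
      * apply (continuous_scal_r (K := R_AbsRing) (V := R_NormedModule)).
        apply (ex_derive_continuous (V := R_NormedModule)).
        eexists. apply (is_derive_rad e He).
      * apply (continuous_minus (K := R_AbsRing) (V := R_NormedModule)); auto.
    + apply (continuous_scal_r (K := R_AbsRing) (V := R_NormedModule)). auto.
  - apply (ex_derive_continuous (V := R_NormedModule)).
    auto_derive. repeat split.
    + eexists. apply (is_derive_pw e He).
    + eexists. apply (is_derive_rad e He).
    + apply Rgt_not_eq, rad_pos, He.
Qed.

Lemma is_derive_growing t : 0 < t < half_time j ->
  is_derive growing t
    (- (g * (pw e g t / rho e t) * y 0%Z t * (e ^ 2 / rad e t ^ 3))
     + c * pw e g t * (acoef c e j (-2) t * y (-2)%Z t + acoef c e j 2 t * y 2%Z t)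
     - g * (pw e g t / rad e t) * ((acoef c e j (-1) t - c) * y (-1)%Z t
                                   - (acoef c e j 1 t - c) * y 1%Z t)).
Proof.
  intros Ht.
  pose proof (derive_resonant c e j y Hy t Ht) as D0.
  pose proof (derive_p1 c e j y Hy t Ht) as D1.
  pose proof (derive_m1 c e j y Hy t Ht) as Dm1.
  rewrite coef_0 in D1, Dm1 by lra.
  pose proof (rad_pos e He t) as HS. pose proof (rho_pos e He t) as Hr.
  pose proof (pw_pos e g t) as HA.
  pose proof (rad_sub_rho e t) as HEE.
  unfold growing.
  auto_derive.
  - repeat split; try (eexists; eassumption).
    + eexists. apply (is_derive_rad e He).
    + eexists. apply (is_derive_pw e He).
    + eexists. apply (is_derive_rad e He).
    + apply Rgt_not_eq, rad_pos, He.
  - rewrite_derivatives He D0 D1 Dm1.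
    replace (pw e g t / rho e t * y 0%Z t * (e ^ 2 / rad e t ^ 3)) with
      (pw e g t * y 0%Z t * ((rad e t - t) / rad e t ^ 3))
      by (rewrite <- HEE; field; lra).
    replace (g * (pw e g t / rho e t) * y 0%Z t * (e ^ 2 / rad e t ^ 3)) with
      (g * pw e g t * y 0%Z t * ((rad e t - t) / rad e t ^ 3))
      by (rewrite <- HEE; field; lra).
    match goal with |- ?l = ?r =>
      assert (Hid : l - r = y 0%Z t * pw e g t / rad e t ^ 2 * (g * (1 - g) - 2 * c ^ 2))
    end.
    { field. lra. }
    rewrite Hcg in Hid. lra.
Qed.

Lemma outward_ratios t : 0 <= t <= half_time j ->
  t / rad e t <= 1 /\ t / rho e t <= 1 / 2 /\ / rad e t <= 2 / rho e t /\
  e ^ 2 / rad e t <= e.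
Proof.
  intros Ht. pose proof (rad_pos e He t). pose proof (rho_pos e He t).
  destruct (rad_bounds e He t (proj1 Ht)) as [HS1 [HS2 _]].
  destruct (rho_bounds e He t (proj1 Ht)) as [[_ Hr1] [_ [Hr2 _]]].
  repeat split.
  - apply div_le; lra.
  - apply div_le; lra.
  - replace (2 / rho e t) with (/ (rho e t / 2)) by (field; lra).
    apply Rinv_le_contravar; lra.
  - apply div_le; nra.
Qed.

(** Bound for the drift of growing over the whole interval, relative to c; the argument X is the
    value of rho^(g - 1/2) at the left end. *)
Let slack (X : R) : R := 88 / 1000 * d + 113 / 1000 * (E * X) + 9 / 100 * W + 124 / 1000 * B.

(** The contribution of the initial value of f is kept apart: it is not small compared with growing
    itself, but its sign is known. *)
Lemma growing_slope s : 0 <= s <= half_time j ->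
  Rabs (- (g * (pw e g s / rho e s) * (y 0%Z s - y 0%Z 0) * (e ^ 2 / rad e s ^ 3))
     + c * pw e g s * (acoef c e j (-2) s * y (-2)%Z s + acoef c e j 2 s * y 2%Z s)
     - g * (pw e g s / rad e s) * ((acoef c e j (-1) s - c) * y (-1)%Z s
                                   - (acoef c e j 1 s - c) * y 1%Z s)) <=
  c * (g * (1277 / 1000 * d + 5 / 2 * (E * (pw e g s / sqrt (rho e s))) + 129 / 100 * W)
         * (e ^ 2 / rad e s ^ 3)
       + (124 / 1000 * B + g * (4 - 2 * j + 3 * e)
          * (d + E * (pw e g s / sqrt (rho e s)) + 103 / 100 * W))).
Proof.
  intros Hs. pose proof outward_time as HT. pose proof outward_B_nonneg as HB0.
  destruct (outward_near s Hs) as [N1 Nm1].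
  destruct (coef_p1 c e j s Hc He1 Hj2 Hs) as [_ C2].
  destruct (coef_m1 c e j s Hc He1 Hj2 Hs) as [_ C5].
  pose proof (outward_resonant s Hs) as HF.
  destruct (outward_weights s Hs) as [A1 [A2 [A3 A4]]].
  destruct (outward_ratios s Hs) as [Q1 [Q2 [Q3 Q4]]].
  pose proof (rad_pos e He s) as HS. pose proof (rho_pos e He s) as Hr.
  pose proof (pw_pos e g s) as HA. pose proof (sqrt_lt_R0 _ Hr) as Hq.
  assert (HW : 0 <= W) by (unfold W; lra).
  assert (F2 : Rabs (acoef c e j (-2) s * y (-2)%Z s + acoef c e j 2 s * y 2%Z s)
               <= 12 / 100 * B).
  { replace (12 / 100 * B) with (6 / 100 * B + 6 / 100 * B) by field.
    apply Rabs_add_le; apply outward_far; auto; lia. }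
  unfold mass in HF.
  set (S := rad e s) in *. set (r := rho e s) in *. set (A := pw e g s) in *.
  set (X := A / sqrt r) in *.
  assert (HD : 0 <= e ^ 2 / S ^ 3).
  { apply Rdiv_le_0_compat; [nra|]. apply pow_lt; auto. }
  set (D := e ^ 2 / S ^ 3) in *.
  assert (HEX : 0 <= E * X).
  { apply Rmult_le_pos; auto. apply Rlt_le, Rdiv_lt_0_compat; auto. }
  set (Z := d / A + E / sqrt r + W) in *.
  assert (HZA : A * Z <= d + E * X + 103 / 100 * W).
  { replace (A * Z) with (d + E * X + A * W) by (unfold Z, X; field; lra). nra. }
  assert (HZ0 : 0 <= Z).
  { unfold Z. assert (0 <= d / A) by (apply Rdiv_le_0_compat; lra).
    assert (0 <= E / sqrt r) by (apply Rdiv_le_0_compat; lra). lra. }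
  assert (B1 : Rabs (g * (A / r) * (y 0%Z s - y 0%Z 0) * D)
          <= c * (g * (1277 / 1000 * d + 5 / 2 * (E * X) + 129 / 100 * W) * D)).
  { rewrite Rabs_mult, (Rabs_pos_eq D) by auto.
    rewrite <- Rmult_assoc. apply Rmult_le_compat_r; auto.
    assert (0 < A / r) by (apply Rdiv_lt_0_compat; auto).
    eapply Rle_trans; [apply Rabs_mul_le; [|exact HF]|].
    - rewrite Rabs_pos_eq; [apply Rle_refl|]. apply Rmult_le_pos; lra.
    - replace (g * (A / r) *
        (5 / 2 * c * (d / (1 - g) * (s / A) + 2 * E * (s / sqrt r) + W * s)))
        with (c * (g * (5 / 2 * (d / (1 - g) * (s / r) + 2 * (E * X) * (s / r)
                 + W * A * (s / r))))) by (unfold X; field; lra).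
      apply Rmult_le_compat_l; [lra|]. apply Rmult_le_compat_l; [lra|].
      assert (0 <= s / r) by (apply Rdiv_le_0_compat; lra).
      assert (0 <= d / (1 - g) <= 1021 / 1000 * d).
      { split; [apply Rdiv_le_0_compat; lra|]. apply div_le; [lra|]. nra. }
      assert (d / (1 - g) * (s / r) <= 1021 / 1000 * d * (1 / 2)) by
        (apply Rmult_le_compat; lra).
      assert (2 * (E * X) * (s / r) <= 2 * (E * X) * (1 / 2)) by
        (apply Rmult_le_compat_l; lra).
      assert (0 <= W * A <= W * (103 / 100)) by nra.
      assert (W * A * (s / r) <= W * (103 / 100) * (1 / 2)) by
        (apply Rmult_le_compat; lra).
      lra. }
  assert (B2 : Rabs (c * A * (acoef c e j (-2) s * y (-2)%Z s + acoef c e j 2 s * y 2%Z s))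
          <= c * (124 / 1000 * B)).
  { apply Rle_trans with (c * (103 / 100) * (12 / 100 * B)).
    - apply Rabs_mul_le; auto. rewrite Rabs_pos_eq by nra. nra.
    - assert (0 <= c * B) by nra. lra. }
  assert (B3 : Rabs (g * (A / S) * ((acoef c e j (-1) s - c) * y (-1)%Z s
                                   - (acoef c e j 1 s - c) * y 1%Z s))
          <= c * (g * (4 - 2 * j + 3 * e) * (d + E * X + 103 / 100 * W))).
  { assert (0 < / S) by (apply Rinv_0_lt_compat; auto).
    assert (0 < A / S) by (apply Rdiv_lt_0_compat; auto).
    eapply Rle_trans; [apply Rabs_mul_le; [|apply Rabs_sub_le; apply Rabs_mul_le; eassumption]|].
    - rewrite Rabs_pos_eq; [apply Rle_refl|]. apply Rmult_le_pos; lra.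
    - replace (g * (A / S) * (c * (6 * (1 - j) * s + 9 / 4 * e ^ 2) * (Z / 2)
          + c * (2 * (1 + j) * s + 9 / 4 * e ^ 2) * (Z / 2)))
        with (c * (g * (((4 - 2 * j) * (s / S) + 9 / 4 * (e ^ 2 / S)) * (A * Z))))
        by (field; lra).
      apply Rmult_le_compat_l; [lra|]. rewrite (Rmult_assoc g).
      apply Rmult_le_compat_l; [lra|].
      assert (0 <= s / S) by (apply Rdiv_le_0_compat; lra).
      assert (0 <= e ^ 2 / S) by (apply Rdiv_le_0_compat; nra).
      apply Rmult_le_compat; auto; try nra. }
  replace (- (g * (A / r) * (y 0%Z s - y 0%Z 0) * D)
     + c * A * (acoef c e j (-2) s * y (-2)%Z s + acoef c e j 2 s * y 2%Z s)
     - g * (A / S) * ((acoef c e j (-1) s - c) * y (-1)%Z s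
                                   - (acoef c e j 1 s - c) * y 1%Z s))
    with (c * A * (acoef c e j (-2) s * y (-2)%Z s + acoef c e j 2 s * y 2%Z s)
      - (g * (A / r) * (y 0%Z s - y 0%Z 0) * D)
      - g * (A / S) * ((acoef c e j (-1) s - c) * y (-1)%Z s
                                   - (acoef c e j 1 s - c) * y 1%Z s)) by ring.
  eapply Rle_trans; [apply Rabs_sub_le; [apply Rabs_sub_le|]; eassumption|]. lra.
Qed.

(** The kernel e^2 / rad^3 is the derivative of t / rad, so it has mass at most 1, whatever e. If f is
    nonnegative at the resonance its contribution to growing is negative, hence the one-sided bound
    without the first term. *)
Lemma outward_drift s t L : 0 <= s <= t -> t <= half_time j ->
  pw e g s / rho e s <= L ->
  Rabs (growing t - growing s)
    <= g * Rabs (y 0%Z 0) * L + c * slack (pw e g s / sqrt (rho e s)) /\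
  (0 <= y 0%Z 0 ->
   growing t - growing s <= c * slack (pw e g s / sqrt (rho e s))).
Proof.
  intros Hst Ht HL. pose proof outward_time as HT. pose proof outward_B_nonneg as HB0.
  assert (HW : 0 <= W) by (unfold W; lra).
  set (X := pw e g s / sqrt (rho e s)).
  assert (HX : 0 < X) by (apply Rdiv_lt_0_compat; [apply pw_pos|];
    apply sqrt_lt_R0, rho_pos, He).
  assert (HEX : 0 <= E * X) by (apply Rmult_le_pos; lra).
  set (m1 := g * (1277 / 1000 * d + 5 / 2 * (E * X) + 129 / 100 * W)).
  set (m2 := 124 / 1000 * B + g * (4 - 2 * j + 3 * e) * (d + E * X + 103 / 100 * W)).
  assert (Hm1 : 0 <= m1) by (unfold m1; apply Rmult_le_pos; lra).
  assert (Hm20 : 0 <= (4 - 2 * j + 3 * e) * (d + E * X + 103 / 100 * W))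
    by (apply Rmult_le_pos; lra).
  assert (HL0 : 0 <= L).
  { apply Rle_trans with (2 := HL). apply Rlt_le, Rdiv_lt_0_compat;
      [apply pw_pos | apply rho_pos, He]. }
  assert (Hsl : m1 * 1 + m2 * (t - s) <= slack X).
  { assert (HjT : (1 - j) * half_time j = 1 / 2) by (unfold half_time; field; lra).
    assert (H4 : (4 - 2 * j + 3 * e) * (t - s) <= 3 + 3 * e).
    { assert ((4 - 2 * j + 3 * e) * (t - s) <= (4 - 2 * j + 3 * e) * half_time j)
        by (apply Rmult_le_compat_l; lra). nra. }
    assert ((4 - 2 * j + 3 * e) * (t - s) * (d + E * X + 103 / 100 * W)
            <= (3 + 3 * e) * (d + E * X + 103 / 100 * W))
      by (apply Rmult_le_compat_r; lra).
    assert (B * (t - s) <= B * 1) by (apply Rmult_le_compat_l; lra).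
    set (Y := d + E * X + 103 / 100 * W) in *.
    assert (HY : 0 <= Y) by (unfold Y; lra).
    assert (m2 * (t - s) <= 124 / 1000 * B + g * ((3 + 3 * e) * Y)).
    { unfold m2.
      replace ((124 / 1000 * B + g * (4 - 2 * j + 3 * e) * Y) * (t - s)) with
        (124 / 1000 * (B * (t - s)) + g * ((4 - 2 * j + 3 * e) * (t - s) * Y)) by ring.
      assert (g * ((4 - 2 * j + 3 * e) * (t - s) * Y) <= g * ((3 + 3 * e) * Y))
        by (apply Rmult_le_compat_l; lra). lra. }
    assert (g * ((3 + 3 * e) * Y) <= 41 / 2000 * ((3 + 3 / 1000000) * Y)).
    { apply Rmult_le_compat; try lra. apply Rmult_le_pos; lra.
      apply Rmult_le_compat_r; lra. }
    assert (m1 <= 41 / 2000 * (1277 / 1000 * d + 5 / 2 * (E * X) + 129 / 100 * W))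
      by (unfold m1; apply Rmult_le_compat_r; lra).
    unfold slack. unfold Y in *. lra. }
  assert (Dphi : forall p q r, is_derive (fun r => p * (r / rad e r) + q * r) r
                    (p * (e ^ 2 / rad e r ^ 3) + q)).
  { intros p q r. pose proof (rad_pos e He r). pose proof (rad_sq e r) as Hsq.
    wderive He. replace (e ^ 2) with (rad e r * rad e r - r ^ 2) by lra. field. lra. }
  assert (Hu : 0 <= t / rad e t <= 1 /\ 0 <= s / rad e s).
  { destruct (outward_ratios t ltac:(lra)) as [? _]. pose proof (rad_pos e He t).
    pose proof (rad_pos e He s).
    repeat split; auto; apply Rdiv_le_0_compat; lra. }
  assert (Hslope : forall r, s < r < t ->
    Rabs (- (g * (pw e g r / rho e r) * (y 0%Z r - y 0%Z 0) * (e ^ 2 / rad e r ^ 3))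
     + c * pw e g r * (acoef c e j (-2) r * y (-2)%Z r + acoef c e j 2 r * y 2%Z r)
     - g * (pw e g r / rad e r) * ((acoef c e j (-1) r - c) * y (-1)%Z r
                                   - (acoef c e j 1 r - c) * y 1%Z r))
    <= c * (m1 * (e ^ 2 / rad e r ^ 3) + m2)).
  { intros r Hr. eapply Rle_trans; [apply growing_slope; lra|].
    apply Rmult_le_compat_l; [lra|].
    assert (HX' : pw e g r / sqrt (rho e r) <= X) by (apply pw_sqrt_ratio_le; lra).
    assert (E * (pw e g r / sqrt (rho e r)) <= E * X) by (apply Rmult_le_compat_l; auto).
    assert (0 <= e ^ 2 / rad e r ^ 3).
    { apply Rdiv_le_0_compat; [nra|]. apply pow_lt, rad_pos, He. }
    apply Rplus_le_compat.
    - apply Rmult_le_compat_r; auto. apply Rmult_le_compat_l; lra.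
    - apply Rplus_le_compat_l. apply Rmult_le_compat_l; [|lra]. apply Rmult_le_pos; lra. }
  assert (Hres : forall r, s < r < t ->
      0 <= pw e g r / rho e r * (e ^ 2 / rad e r ^ 3) <= L * (e ^ 2 / rad e r ^ 3)).
  { intros r Hr.
    assert (0 <= e ^ 2 / rad e r ^ 3).
    { apply Rdiv_le_0_compat; [nra|]. apply pow_lt, rad_pos, He. }
    assert (0 <= pw e g r / rho e r).
    { apply Rlt_le, Rdiv_lt_0_compat; [apply pw_pos | apply rho_pos, He]. }
    split; [apply Rmult_le_pos; auto|]. apply Rmult_le_compat_r; auto.
    apply Rle_trans with (2 := HL). apply pw_rho_ratio_le. lra. }
  set (dN := fun t => (- (g * (pw e g t / rho e t) * y 0%Z t * (e ^ 2 / rad e t ^ 3))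
     + c * pw e g t * (acoef c e j (-2) t * y (-2)%Z t + acoef c e j 2 t * y 2%Z t)
     - g * (pw e g t / rad e t) * ((acoef c e j (-1) t - c) * y (-1)%Z t
                                   - (acoef c e j 1 t - c) * y 1%Z t))).
  split.
  - set (k := g * Rabs (y 0%Z 0) * L).
    assert (Hk : 0 <= k).
    { unfold k. apply Rmult_le_pos; auto. apply Rmult_le_pos; [lra|apply Rabs_pos]. }
    assert (Rabs (growing t - growing s) <=
      ((k + c * m1) * (t / rad e t) + c * m2 * t)
       - ((k + c * m1) * (s / rad e s) + c * m2 * s)) as Hinc.
    { apply (increment_abs_le growing
        (fun r => (k + c * m1) * (r / rad e r) + c * m2 * r) dN
        (fun r => (k + c * m1) * (e ^ 2 / rad e r ^ 3) + c * m2)).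
      - lra.
      - intros r Hr. apply continuous_growing. lra.
      - intros r Hr. apply Dphi.
      - intros r Hr. apply is_derive_growing. lra.
      - intros r Hr. specialize (Hslope r Hr). specialize (Hres r Hr).
        replace (dN r) with ((- (g * (pw e g r / rho e r) * (y 0%Z r - y 0%Z 0) * (e ^ 2 / rad e r ^ 3))
     + c * pw e g r * (acoef c e j (-2) r * y (-2)%Z r + acoef c e j 2 r * y 2%Z r)
     - g * (pw e g r / rad e r) * ((acoef c e j (-1) r - c) * y (-1)%Z r
                                   - (acoef c e j 1 r - c) * y 1%Z r))
           - g * y 0%Z 0 * (pw e g r / rho e r * (e ^ 2 / rad e r ^ 3)))
          by (unfold dN; ring).
        replace ((k + c * m1) * (e ^ 2 / rad e r ^ 3) + c * m2) with
          (c * (m1 * (e ^ 2 / rad e r ^ 3) + m2) + k * (e ^ 2 / rad e r ^ 3)) by ring.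
        apply Rabs_sub_le; auto. unfold k. rewrite (Rmult_assoc (g * Rabs (y 0%Z 0))). apply Rabs_mul_le.
        + rewrite Rabs_mult, (Rabs_pos_eq g); lra.
        + rewrite Rabs_pos_eq; lra. }
    assert (k * (t / rad e t) <= k * 1) by (apply Rmult_le_compat_l; lra).
    assert (m1 * (t / rad e t) <= m1 * 1) by (apply Rmult_le_compat_l; lra).
    assert (0 <= k * (s / rad e s)) by (apply Rmult_le_pos; lra).
    assert (0 <= m1 * (s / rad e s)) by (apply Rmult_le_pos; lra).
    assert (c * (m1 * (t / rad e t) + m2 * t - (m1 * (s / rad e s) + m2 * s)) <= c * slack X)
      by (apply Rmult_le_compat_l; lra).
    lra.
  - intros Hpos.
    assert (growing t - growing s <=
      (c * m1 * (t / rad e t) + c * m2 * t)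
       - (c * m1 * (s / rad e s) + c * m2 * s)) as Hinc.
    { apply (increment_le growing
        (fun r => c * m1 * (r / rad e r) + c * m2 * r) dN
        (fun r => c * m1 * (e ^ 2 / rad e r ^ 3) + c * m2)).
      - lra.
      - intros r Hr. apply continuous_growing. lra.
      - intros r Hr. apply (ex_derive_continuous (V := R_NormedModule)).
        eexists. apply Dphi.
      - intros r Hr. apply is_derive_growing. lra.
      - intros r Hr. apply Dphi.
      - intros r Hr. specialize (Hslope r Hr). specialize (Hres r Hr).
        apply Rabs_le_between in Hslope.
        assert (0 <= g * y 0%Z 0 * (pw e g r / rho e r * (e ^ 2 / rad e r ^ 3)))
          by (apply Rmult_le_pos; [apply Rmult_le_pos|]; lra).
        unfold dN. lra. }
    assert (m1 * (t / rad e t) <= m1 * 1) by (apply Rmult_le_compat_l; lra).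
    assert (0 <= m1 * (s / rad e s)) by (apply Rmult_le_pos; lra).
    assert (c * (m1 * (t / rad e t) + m2 * t - (m1 * (s / rad e s) + m2 * s)) <= c * slack X)
      by (apply Rmult_le_compat_l; lra).
    lra.
Qed.

Lemma mass_le t : 0 <= t <= half_time j -> mass t <= 1033 / 1000 * d + 142 / 100 * E + W.
Proof.
  intros Ht. pose proof outward_time as HT. pose proof outward_B_nonneg as HB0.
  destruct (outward_weights t Ht) as [A1 [A2 [A3 A4]]].
  assert (HW : 0 <= W) by (unfold W; lra).
  assert (H1 : 0 <= d / (1 - g) <= 1021 / 1000 * d).
  { split; [apply Rdiv_le_0_compat; lra|]. apply div_le; [lra|]. nra. }
  assert (0 <= t / pw e g t) by (apply Rdiv_le_0_compat; [lra|apply pw_pos]).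
  assert (d / (1 - g) * (t / pw e g t) <= 1021 / 1000 * d * (1011 / 1000))
    by (apply Rmult_le_compat; lra).
  assert (2 * E * (t / sqrt (rho e t)) <= 2 * E * (71 / 100))
    by (apply Rmult_le_compat_l; lra).
  assert (W * t <= W * 1) by (apply Rmult_le_compat_l; lra).
  unfold mass. lra.
Qed.

(** The definition of growing solved for v, with f bounded through mass. *)
Lemma outward_recover t : 0 <= t <= half_time j ->
  Rabs (c * pw e g t * (y (-1)%Z t - y 1%Z t)) <=
  Rabs (growing t) + 2 * (g * Rabs (y 0%Z 0) * (pw e g t / rho e t))
  + c * (53 / 1000 * d + 103 / 1000 * (E * (pw e g t / sqrt (rho e t))) + 53 / 1000 * W).
Proof.
  intros Ht. pose proof outward_time as HT. pose proof outward_B_nonneg as HB0.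
  pose proof (outward_resonant t Ht) as HF.
  destruct (outward_weights t Ht) as [A1 [A2 [A3 A4]]].
  destruct (outward_ratios t Ht) as [Q1 [Q2 [Q3 Q4]]].
  pose proof (rad_pos e He t) as HS. pose proof (rho_pos e He t) as Hr.
  pose proof (pw_pos e g t) as HA. pose proof (sqrt_lt_R0 _ Hr) as Hq.
  assert (HW : 0 <= W) by (unfold W; lra).
  replace (c * pw e g t * (y (-1)%Z t - y 1%Z t)) with
    (growing t + (g * (pw e g t / rad e t) * y 0%Z 0
                  + g * (pw e g t / rad e t) * (y 0%Z t - y 0%Z 0)))
    by (unfold growing; field; lra).
  unfold mass in HF.
  set (S := rad e t) in *. set (r := rho e t) in *. set (A := pw e g t) in *.
  set (X := A / sqrt r) in *.
  assert (HEX : 0 <= E * X).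
  { apply Rmult_le_pos; auto. apply Rlt_le, Rdiv_lt_0_compat; auto. }
  assert (HAS : 0 < A / S <= 2 * (A / r)).
  { split; [apply Rdiv_lt_0_compat; auto|].
    replace (2 * (A / r)) with (A * (2 / r)) by (field; lra).
    apply Rmult_le_compat_l; lra. }
  assert (B1 : Rabs (g * (A / S) * y 0%Z 0) <= 2 * (g * Rabs (y 0%Z 0) * (A / r))).
  { rewrite Rabs_mult, Rabs_pos_eq by (apply Rmult_le_pos; lra).
    assert (0 <= g * Rabs (y 0%Z 0)) by (apply Rmult_le_pos; [lra|apply Rabs_pos]).
    assert (g * Rabs (y 0%Z 0) * (A / S) <= g * Rabs (y 0%Z 0) * (2 * (A / r)))
      by (apply Rmult_le_compat_l; lra).
    lra. }
  assert (B2 : Rabs (g * (A / S) * (y 0%Z t - y 0%Z 0)) <=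
    c * (53 / 1000 * d + 103 / 1000 * (E * X) + 53 / 1000 * W)).
  { eapply Rle_trans; [apply Rabs_mul_le; [|exact HF]|].
    - rewrite Rabs_pos_eq; [apply Rle_refl|]. apply Rmult_le_pos; lra.
    - replace (g * (A / S) *
        (5 / 2 * c * (d / (1 - g) * (t / A) + 2 * E * (t / sqrt r) + W * t)))
        with (c * (g * (5 / 2 * (d / (1 - g) * (t / S) + 2 * (E * X) * (t / S)
                 + W * A * (t / S))))) by (unfold X; field; lra).
      apply Rmult_le_compat_l; [lra|].
      assert (0 <= t / S) by (apply Rdiv_le_0_compat; lra).
      assert (0 <= d / (1 - g) <= 1021 / 1000 * d).
      { split; [apply Rdiv_le_0_compat; lra|]. apply div_le; [lra|]. nra. }
      assert (d / (1 - g) * (t / S) <= 1021 / 1000 * d * 1) by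
        (apply Rmult_le_compat; lra).
      assert (2 * (E * X) * (t / S) <= 2 * (E * X) * 1) by
        (apply Rmult_le_compat_l; lra).
      assert (0 <= W * A <= W * (103 / 100)) by nra.
      assert (0 <= W * A * (t / S) <= W * (103 / 100) * 1) by
        (split; [apply Rmult_le_pos | apply Rmult_le_compat]; lra).
      assert (0 <= d / (1 - g) * (t / S)) by (apply Rmult_le_pos; lra).
      assert (0 <= 2 * (E * X) * (t / S)) by (apply Rmult_le_pos; lra).
      set (u := d / (1 - g) * (t / S) + 2 * (E * X) * (t / S) + W * A * (t / S)) in *.
      assert (g * (5 / 2 * u) <= 41 / 2000 * (5 / 2 * u)) by
        (apply Rmult_le_compat_r; unfold u; lra).
      unfold u in *. lra. }
  eapply Rle_trans; [apply Rabs_add_le; [apply Rle_refl|apply Rabs_add_le; eassumption]|].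
  lra.
Qed.

End Given.

Lemma outward_tail_of_jump d E : 0 <= d -> 0 <= E ->
  (forall t, 0 <= t <= half_time j ->
     Rabs (y (-1)%Z t - y 1%Z t) <= d / pw e g t + E / sqrt (rho e t)) ->
  forall l t, (2 <= Z.abs l)%Z -> 0 <= t <= half_time j ->
    Rabs (y l t) <= 54 / 10 + 25 / 100 * d + 34 / 100 * E.
Proof.
  intros Hd HE Hv l t Hl Ht.
  destruct (hf_bdd _ _ _ _ Hy) as [M HM].
  apply Rle_trans with ((46 / 10 + 2066 / 10000 * d + 284 / 1000 * E) / (1 - 144 / 1000));
    [|lra].
  apply (self_improving_bound (Z * R)
    (fun p => (2 <= Z.abs (fst p))%Z /\ 0 <= snd p <= half_time j)
    (fun p => Rabs (y (fst p) (snd p)))) with (i := (l, t)); simpl; try lra; auto.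
  - exists M. intros [k s] [Hk Hs]. apply HM; auto.
  - intros B HB0 HB' [k s] [Hk Hs]. simpl.
    assert (HB : forall l t, (2 <= Z.abs l)%Z -> 0 <= t <= half_time j -> Rabs (y l t) <= B).
    { intros k' s' Hk' Hs'. apply (HB' (k', s')); auto. }
    pose proof (outward_tail d E B Hd HE Hv HB k s Hk Hs).
    pose proof (mass_le d E B Hd HE HB s Hs). cbv zeta in *. lra.
Qed.

Section GivenJump.
Context (d E : R) (Hd : 0 <= d) (HE : 0 <= E)
  (Hv : forall t, 0 <= t <= half_time j ->
     Rabs (y (-1)%Z t - y 1%Z t) <= d / pw e g t + E / sqrt (rho e t)).

Lemma drift_of_jump s t L : 0 <= s <= t -> t <= half_time j ->
  pw e g s / rho e s <= L ->
  Rabs (growing t - growing s)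
    <= g * Rabs (y 0%Z 0) * L
       + c * (122 / 1000 * d + 18 / 100 * (E * (pw e g s / sqrt (rho e s))) + 1) /\
  (0 <= y 0%Z 0 ->
   growing t - growing s
     <= c * (122 / 1000 * d + 18 / 100 * (E * (pw e g s / sqrt (rho e s))) + 1)).
Proof.
  intros Hst Ht HL.
  pose proof (outward_tail_of_jump d E Hd HE Hv) as HB.
  pose proof (outward_drift d E _ Hd HE Hv HB s t L Hst Ht HL) as H. cbv zeta in H.
  destruct (outward_weights s ltac:(lra)) as [_ [_ [_ A4]]].
  set (X := pw e g s / sqrt (rho e s)) in *.
  assert (E * (7 / 10) <= E * X) by (apply Rmult_le_compat_l; lra).
  match type of H with _ <= _ + c * ?u /\ _ =>
    assert (c * u <= c * (122 / 1000 * d + 18 / 100 * (E * X) + 1))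
      by (apply Rmult_le_compat_l; lra) end.
  destruct H as [D1 D2]. split; [lra|]. intros Hp. specialize (D2 Hp). lra.
Qed.

Lemma recover_of_jump t : 0 <= t <= half_time j ->
  Rabs (c * pw e g t * (y (-1)%Z t - y 1%Z t)) <=
  Rabs (growing t) + 2 * (g * Rabs (y 0%Z 0) * (pw e g t / rho e t))
  + c * (55 / 1000 * d + 107 / 1000 * (E * (pw e g t / sqrt (rho e t))) + 2 / 10).
Proof.
  intros Ht.
  pose proof (outward_tail_of_jump d E Hd HE Hv) as HB.
  pose proof (outward_recover d E _ Hd HE Hv HB t Ht) as H. cbv zeta in H.
  destruct (outward_weights t Ht) as [_ [_ [_ A4]]].
  set (X := pw e g t / sqrt (rho e t)) in *.
  assert (E * (7 / 10) <= E * X) by (apply Rmult_le_compat_l; lra).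
  match type of H with _ <= _ + c * ?u =>
    assert (c * u <= c * (55 / 1000 * d + 107 / 1000 * (E * X) + 2 / 10))
      by (apply Rmult_le_compat_l; lra) end.
  lra.
Qed.

End GivenJump.

Let a := pw e g 0.

Lemma pw_rho_le_start t : 0 <= t <= half_time j -> pw e g t / rho e t <= a / e.
Proof.
  intros Ht. pose proof (pw_rho_ratio_le 0 t ltac:(lra)) as H.
  rewrite rho_0 in H by auto. exact H.
Qed.

(** The bootstrap with E = 0: all of v is controlled by the state at the resonance. *)
Lemma jump_bound t : 0 <= t <= half_time j ->
  Rabs (c * pw e g t * (y (-1)%Z t - y 1%Z t)) <=
  (Rabs (growing 0) + 3 * (g * Rabs (y 0%Z 0) * (a / e)) + 12 / 10 * c) / (1 - 177 / 1000).
Proof.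
  intros Ht. pose proof outward_time as HT.
  assert (Hae : 0 < a / e) by (apply Rdiv_lt_0_compat; [apply pw_pos|auto]).
  assert (HF : 0 <= g * Rabs (y 0%Z 0)) by (apply Rmult_le_pos; [lra|apply Rabs_pos]).
  apply (self_improving_bound R (fun s => 0 <= s <= half_time j)
      (fun s => Rabs (c * pw e g s * (y (-1)%Z s - y 1%Z s)))); auto; try lra.
  - assert (0 <= g * Rabs (y 0%Z 0) * (a / e)) by (apply Rmult_le_pos; lra).
    pose proof (Rabs_pos (growing 0)). lra.
  - destruct (hf_bdd _ _ _ _ Hy) as [M HM].
    exists (1 / 10 * (103 / 100) * (M + M)). intros s Hs.
    pose proof (pw_pos e g s) as HA. destruct (outward_weights s Hs) as [A1 _].
    apply Rabs_mul_le; [|apply Rabs_sub_le; auto].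
    rewrite Rabs_pos_eq by nra. apply Rmult_le_compat; lra.
  - intros K HK HKb s Hs.
    assert (Hv : forall t, 0 <= t <= half_time j ->
       Rabs (y (-1)%Z t - y 1%Z t) <= K / c / pw e g t + 0 / sqrt (rho e t)).
    { intros r Hr. specialize (HKb r Hr). pose proof (pw_pos e g r) as HA.
      rewrite Rabs_mult, Rabs_pos_eq in HKb by nra.
      replace (0 / sqrt (rho e r)) with 0 by (unfold Rdiv; ring). rewrite Rplus_0_r.
      apply le_div; auto. apply le_div; auto. lra. }
    assert (HKc : 0 <= K / c) by (apply Rdiv_le_0_compat; lra).
    assert (HcK : c * (K / c) = K) by (field; lra).
    pose proof (recover_of_jump (K / c) 0 HKc ltac:(lra) Hv s Hs) as H1.
    destruct (drift_of_jump (K / c) 0 HKc ltac:(lra) Hv 0 s (a / e)) as [H2 _]; try lra.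
    { apply pw_rho_le_start. lra. }
    pose proof (pw_rho_le_start s Hs) as H3.
    assert (g * Rabs (y 0%Z 0) * (pw e g s / rho e s) <= g * Rabs (y 0%Z 0) * (a / e))
      by (apply Rmult_le_compat_l; lra).
    assert (Rabs (growing s) <= Rabs (growing 0) + Rabs (growing s - growing 0))
      by (split_Rabs; lra).
    rewrite !Rmult_0_l in *.
    set (z := K / c) in *. nra.
Qed.

Lemma rate_le : g <= 21 / 100 * c.
Proof. nra. Qed.

Lemma rate_ge : 2 * c ^ 2 <= g.
Proof. nra. Qed.

Lemma start_weight : sqrt e <= a <= 1.
Proof.
  split.
  - apply sqrt_le_start; lra.
  - pose proof (pw_le e He g 0 ltac:(lra)) as H. rewrite rho_0 in H by auto.
    fold a in H. nra.
Qed.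

Lemma start_resonant_le : g * Rabs (y 0%Z 0) <= 336 / 1000 * (c * a).
Proof.
  pose proof rate_le. pose proof start_weight as [_ Ha].
  assert (0 < a) by apply pw_pos. fold a in Hf0.
  apply Rle_trans with (21 / 100 * c * (16 / 10 * a)); [|lra].
  apply Rmult_le_compat; auto using Rabs_pos. lra.
Qed.

(** The rank-one property behind the comparison of all modes: whatever the solution, v is
    controlled by the final value of growing, up to a contribution e^(-1/2) rho^(-1/2) that is
    negligible at the end. Here growing is estimated backwards from the end. *)
Lemma jump_profile t : 0 <= t <= half_time j ->
  Rabs (y (-1)%Z t - y 1%Z t) <=
  10 / 7 * (Rabs (growing (half_time j)) / c) / pw e g t
  + 10 / 7 * (2 / sqrt e) / sqrt (rho e t).
Proof.
  intros Ht. pose proof outward_time as HT.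
  set (D := Rabs (growing (half_time j))). assert (HD : 0 <= D) by apply Rabs_pos.
  destruct (sqrt_small e He ltac:(lra)) as [Hh Hh1]. pose proof start_weight as [_ Ha1].
  pose proof start_resonant_le as Hgf.
  assert (Ha : 0 < a) by apply pw_pos.
  (* E0 absorbs the contribution of the initial f, at most 1.01 / sqrt e *)
  set (E0 := 2 / sqrt e). assert (HE0 : 2000 <= E0) by (unfold E0, Rdiv; lra).
  assert (HDc : 0 <= D / c) by (apply Rdiv_le_0_compat; lra).
  set (V := fun s => D / c / pw e g s + E0 / sqrt (rho e s)).
  assert (HV : forall s, 0 <= s <= half_time j -> 1 <= V s).
  { intros s Hs. destruct (outward_weights s Hs) as [A1 [_ [_ A4]]].
    pose proof (pw_pos e g s) as HA. pose proof (rho_pos e He s) as Hr.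
    pose proof (sqrt_lt_R0 _ Hr) as Hq.
    assert (0 <= D / c / pw e g s) by (apply Rdiv_le_0_compat; lra).
    assert (7 / 10 / (103 / 100) <= / sqrt (rho e s)).
    { apply div_le; [lra|]. apply Rle_trans with (1 := A4). unfold Rdiv at 1.
      rewrite Rmult_comm. apply Rmult_le_compat_l; auto.
      apply Rlt_le, Rinv_0_lt_compat; auto. }
    unfold V, Rdiv at 3. nra. }
  assert (Main : forall s, 0 <= s <= half_time j ->
            Rabs (y (-1)%Z s - y 1%Z s) / V s <= 1 / (1 - 3 / 10)).
  { apply (self_improving_bound R (fun s => 0 <= s <= half_time j)
      (fun s => Rabs (y (-1)%Z s - y 1%Z s) / V s)); try lra.
    - destruct (hf_bdd _ _ _ _ Hy) as [M HM]. exists (M + M). intros s Hs.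
      specialize (HV s Hs).
      assert (Hj0 : Rabs (y (-1)%Z s - y 1%Z s) <= M + M) by (apply Rabs_sub_le; auto).
      pose proof (Rabs_pos (y (-1)%Z s - y 1%Z s)).
      apply div_le; [lra|]. nra.
    - intros m Hm Hmb s Hs.
      assert (Hv : forall t, 0 <= t <= half_time j ->
         Rabs (y (-1)%Z t - y 1%Z t) <= m * (D / c) / pw e g t + m * E0 / sqrt (rho e t)).
      { intros r Hr. specialize (Hmb r Hr). specialize (HV r Hr).
        replace (m * (D / c) / pw e g r + m * E0 / sqrt (rho e r)) with (m * V r)
          by (unfold V, Rdiv; ring).
        replace (Rabs (y (-1)%Z r - y 1%Z r)) with
          (Rabs (y (-1)%Z r - y 1%Z r) / V r * V r) by (field; lra).
        apply Rmult_le_compat_r; lra. }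
      assert (Hd : 0 <= m * (D / c)) by (apply Rmult_le_pos; lra).
      assert (HE : 0 <= m * E0) by (apply Rmult_le_pos; lra).
      pose proof (recover_of_jump _ _ Hd HE Hv s Hs) as H1.
      destruct (drift_of_jump _ _ Hd HE Hv s (half_time j) (pw e g s / rho e s))
        as [H2 _]; try lra.
      destruct (outward_weights s Hs) as [A1 [_ [_ A4]]].
      destruct (rho_bounds e He s (proj1 Hs)) as [_ [Hr2 _]].
      pose proof (pw_pos e g s) as HA. pose proof (rho_pos e He s) as Hr.
      pose proof (sqrt_lt_R0 _ Hr) as Hq. pose proof (sqrt_sqrt _ (Rlt_le _ _ Hr)) as Hqq.
      assert (Hqe : sqrt e <= sqrt (rho e s)) by (apply sqrt_le_1; lra).
      specialize (HV s Hs).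
      assert (HVs : c * pw e g s * V s = D + c * (pw e g s / sqrt (rho e s) * E0))
        by (unfold V; field; lra).
      assert (HL : pw e g s / rho e s <= pw e g s / sqrt (rho e s) * (E0 / 2)).
      { replace (pw e g s / rho e s) with (pw e g s / sqrt (rho e s) * / sqrt (rho e s)).
        - apply Rmult_le_compat_l; [lra|].
          replace (E0 / 2) with (/ sqrt e) by (unfold E0; field; lra).
          apply Rinv_le_contravar; lra.
        - rewrite <- Hqq at 3. field. lra. }
      rewrite Rabs_mult, Rabs_pos_eq in H1 by nra.
      set (J := Rabs (y (-1)%Z s - y 1%Z s)) in *.
      set (X := pw e g s / sqrt (rho e s)) in *. set (L := pw e g s / rho e s) in *.
      assert (HN : Rabs (growing s) <= D + Rabs (growing (half_time j) - growing s)).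
      { unfold D. split_Rabs; lra. }
      assert (HcX : 0 <= c * (X * E0)) by (apply Rmult_le_pos; [lra|]; apply Rmult_le_pos; lra).
      assert (HfL : g * Rabs (y 0%Z 0) * L <= 168 / 1000 * (c * (X * E0))).
      { apply Rle_trans with (336 / 1000 * c * (X * (E0 / 2))); [|lra].
        apply Rmult_le_compat; auto.
        - apply Rmult_le_pos; [lra | apply Rabs_pos].
        - apply Rlt_le, Rdiv_lt_0_compat; auto.
        - nra. }
      assert (HXE : 7 / 10 * 2000 <= X * E0) by (apply Rmult_le_compat; lra).
      assert (Hc1200 : 12 / 10 * c <= 1 / 100 * (c * (X * E0))).
      { assert (c * (7 / 10 * 2000) <= c * (X * E0)) by (apply Rmult_le_compat_l; lra). lra. }
      assert (HcD : c * (m * (D / c)) = m * D) by (field; lra).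
      assert (HcE : c * (m * E0 * X) = m * (c * (X * E0))) by ring.
      assert (H3 : c * pw e g s * J <= (1 + 3 / 10 * m) * (D + c * (X * E0))).
      { set (P := c * (X * E0)) in *. 
        replace (c * (55 / 1000 * (m * (D / c)) + 107 / 1000 * (m * E0 * X) + 2 / 10))
          with (55 / 1000 * (m * D) + 107 / 1000 * (m * P) + 2 / 10 * c) in H1
          by (rewrite <- HcD, <- HcE; ring).
        replace (c * (122 / 1000 * (m * (D / c)) + 18 / 100 * (m * E0 * X) + 1))
          with (122 / 1000 * (m * D) + 18 / 100 * (m * P) + c) in H2
          by (rewrite <- HcD, <- HcE; ring).
        assert (0 <= m * D) by (apply Rmult_le_pos; lra).
        assert (0 <= m * P) by (apply Rmult_le_pos; lra).
        lra. }
      rewrite <- HVs in H3.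
      apply div_le; [lra|].
      apply Rmult_le_reg_l with (c * pw e g s); [nra|]. lra. }
  specialize (Main t Ht). specialize (HV t Ht).
  replace (10 / 7 * (D / c) / pw e g t + 10 / 7 * E0 / sqrt (rho e t)) with (10 / 7 * V t)
    by (unfold V, Rdiv; ring).
  replace (Rabs (y (-1)%Z t - y 1%Z t)) with
    (Rabs (y (-1)%Z t - y 1%Z t) / V t * V t) by (field; lra).
  apply Rmult_le_compat_r; lra.
Qed.

Lemma outward_end_weight : 1 <= pw e g (half_time j) <= 103 / 100.
Proof.
  pose proof outward_time as HT. set (T := half_time j) in *.
  destruct (outward_weights T ltac:(split; [lra | apply Rle_refl])) as [A1 _]. split; auto.
  unfold pw. rewrite <- (Rpower_O (rho e T)) at 1 by (apply rho_pos; auto).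
  destruct (rho_bounds e He T ltac:(lra)) as [_ [_ [? _]]].
  apply Rle_Rpower; lra.
Qed.

Lemma growing_start :
  growing 0 = c * a * (y (-1)%Z 0 - y 1%Z 0) - g * y 0%Z 0 * (a / e).
Proof. unfold growing. rewrite rad_0 by auto. fold a. field. lra. Qed.

Lemma start_scale : 1 <= a ^ 2 / e.
Proof.
  pose proof start_weight as [Ha _]. destruct (sqrt_small e He ltac:(lra)) as [Hh _].
  pose proof (sqrt_sqrt e ltac:(lra)). apply le_div; auto. nra.
Qed.

Lemma jump_bound_scale t : 0 <= t <= half_time j ->
  Rabs (y (-1)%Z t - y 1%Z t) <= 7 * (a ^ 2 / e) / pw e g t + 0 / sqrt (rho e t).
Proof.
  intros Ht. pose proof (jump_bound t Ht) as H.
  pose proof start_scale as HZ. pose proof start_resonant_le as Hgf.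
  assert (Ha : 0 < a) by apply pw_pos. fold a in Hv0. pose proof (pw_pos e g t) as HA.
  assert (Hae : 0 < a / e) by (apply Rdiv_lt_0_compat; auto).
  set (Z := a ^ 2 / e) in *.
  assert (HN : Rabs (growing 0) <= 3336 / 1000 * (c * Z)).
  { rewrite growing_start. 
    apply Rle_trans with (c * a * (3 * (a / e)) + 336 / 1000 * (c * a) * (a / e)).
    - apply Rabs_sub_le; apply Rabs_mul_le; auto.
      + rewrite Rabs_pos_eq; nra.
      + rewrite Rabs_mult, Rabs_pos_eq; lra.
      + rewrite Rabs_pos_eq; lra.
    - unfold Z. right. field. lra. }
  assert (HF : g * Rabs (y 0%Z 0) * (a / e) <= 336 / 1000 * (c * Z)).
  { apply Rle_trans with (336 / 1000 * (c * a) * (a / e)).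
    - apply Rmult_le_compat_r; lra.
    - unfold Z. right. field. lra. }
  assert (HcZ : c * 1 <= c * Z) by (apply Rmult_le_compat_l; lra).
  rewrite Rabs_mult, Rabs_pos_eq in H by nra.
  replace (0 / sqrt (rho e t)) with 0 by (unfold Rdiv; ring). rewrite Rplus_0_r.
  apply le_div; auto. apply Rmult_le_reg_l with c; auto. lra.
Qed.

(** At the end the two neighbours are, to leading order, opposite and equal to half the jump, while f and
    the tail are smaller by factors of order c. In the third part the contribution of the initial
    f and that of the initial jump to growing have the same sign up to lower order, and the bootstrap
    constant 0.122 * 4 / 0.823 is below 1, so growing keeps a fixed fraction of its initial size. *)
Lemma outward_conclusion :
  (forall l, Rabs (y l (half_time j))
     <= 16 / 10 * Rabs (y (-1)%Z (half_time j)) + 3 / sqrt e) /\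
  Rabs (y (-1)%Z (half_time j)) <= 6 * (a ^ 2 / e) /\
  (8 / 100 * a <= y 0%Z 0 -> y (-1)%Z 0 - y 1%Z 0 <= 3 / sqrt e ->
   24 / 1000 * c * (a ^ 2 / e) - 3 / sqrt e <= Rabs (y (-1)%Z (half_time j))).
Proof.
  pose proof outward_time as HT. set (T := half_time j) in *.
  assert (HT' : 0 <= T <= half_time j) by (split; [lra | apply Rle_refl]).
  destruct (sqrt_small e He ltac:(lra)) as [Hh Hh1]. pose proof start_weight as [_ Ha1].
  assert (Ha : 0 < a) by apply pw_pos.
  destruct outward_end_weight as [HA1 HA2]. fold T in HA1, HA2.
  pose proof start_scale as HZ. pose proof rate_le as Hgc. pose proof rate_ge as Hgc2.
  set (G := Rabs (growing T) / c).
  assert (HG : 0 <= G) by (apply Rdiv_le_0_compat; auto using Rabs_pos).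
  assert (HcG : c * G = Rabs (growing T)) by (unfold G; field; lra).
  set (h := / sqrt e) in *.
  assert (Hd : 0 <= 10 / 7 * G) by lra.
  assert (HE : 0 <= 10 / 7 * (2 / sqrt e)) by (unfold Rdiv; fold h; lra).
  pose proof (jump_profile : forall t, 0 <= t <= half_time j -> Rabs (y (-1)%Z t - y 1%Z t) <=
     10 / 7 * G / pw e g t + 10 / 7 * (2 / sqrt e) / sqrt (rho e t)) as Hv.
  pose proof (outward_tail_of_jump _ _ Hd HE Hv) as HB.
  pose proof (outward_sum _ _ _ Hv HB T HT') as Hsum.
  pose proof (mass_le _ _ _ Hd HE HB T HT') as Hmass. 
  pose proof (outward_resonant _ _ _ Hd HE Hv HB T HT') as Hres.
  cbv beta in Hres, Hmass.
  match type of Hmass with ?u <= _ => set (m := u) in Hmass, Hres end.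
  assert (HEh : 10 / 7 * (2 / sqrt e) = 20 / 7 * h) by (unfold h, Rdiv; field; lra).
  rewrite HEh in *. clear HEh.
  assert (Hm0 : 0 <= m).
  { apply Rmult_le_reg_l with (5 / 2 * c); [lra|]. rewrite Rmult_0_r.
    apply Rle_trans with (2 := Hres). apply Rabs_pos. }
  assert (Hm : 5 / 2 * c * m <= 1 / 4 * m) by (apply Rmult_le_compat_r; lra).
  assert (Hf : Rabs (y 0%Z T) <= 38 / 100 * G + 105 / 100 * h + 3).
  { fold a in Hf0. replace (y 0%Z T) with (y 0%Z 0 + (y 0%Z T - y 0%Z 0)) by ring.
    eapply Rle_trans; [apply Rabs_add_le; eassumption|]. lra. }
  assert (Hw : Rabs (y (-1)%Z T + y 1%Z T) <= 43 / 1000 * G + 117 / 1000 * h + 37 / 10) by lra.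
  assert (HS : 0 < rad e T) by (apply rad_pos; auto).
  assert (HS2 : 1 / 2 <= rad e T) by (destruct (rad_bounds e He T (proj1 HT')); lra).
  assert (HAT : 0 < pw e g T) by apply pw_pos.
  assert (Hjump : Rabs ((y (-1)%Z T - y 1%Z T) - growing T / (c * pw e g T))
            <= 16 / 100 * G + 45 / 100 * h + 2).
  { replace ((y (-1)%Z T - y 1%Z T) - growing T / (c * pw e g T)) with
      (g / (c * rad e T) * y 0%Z T) by (unfold growing; field; lra).
    assert (g / (c * rad e T) <= 42 / 100).
    { apply div_le; [nra|]. nra. }
    apply Rle_trans with (42 / 100 * (38 / 100 * G + 105 / 100 * h + 3)); [|lra].
    apply Rabs_mul_le; auto. rewrite Rabs_pos_eq; auto. apply Rdiv_le_0_compat; nra. }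
  assert (HGA : 97 / 100 * G <= Rabs (growing T / (c * pw e g T)) <= G).
  { replace (growing T / (c * pw e g T)) with (growing T / c * / pw e g T) by (field; lra).
    rewrite Rabs_mult, (Rabs_pos_eq (/ _)) by (apply Rlt_le, Rinv_0_lt_compat; auto).
    replace (Rabs (growing T / c)) with G.
    - assert (97 / 100 <= / pw e g T <= 1).
      { split.
        - replace (97 / 100) with (/ (100 / 97)) by field. apply Rinv_le_contravar; lra.
        - rewrite <- Rinv_1. apply Rinv_le_contravar; lra. }
      split; nra.
    - unfold G, Rdiv. rewrite Rabs_mult, (Rabs_pos_eq (/ c)); auto.
      apply Rlt_le, Rinv_0_lt_compat; auto. }
  assert (Hq : 38 / 100 * G - 3 / 10 * h <= Rabs (y (-1)%Z T)).
  { pose proof (Rabs_le_half_sum (y 1%Z T) (y (-1)%Z T) (growing T / (c * pw e g T))). lra. }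
  assert (Hp : Rabs (y 1%Z T) <= 605 / 1000 * G + 4 / 10 * h).
  { pose proof (Rabs_other_le (y 1%Z T) (y (-1)%Z T) (growing T / (c * pw e g T))). lra. }
  replace (3 / sqrt e) with (3 * h) by (unfold h; field; lra).
  split; [|split].
  - intros l.
    assert (Hcase : (2 <= Z.abs l)%Z \/ l = 0%Z \/ l = 1%Z \/ l = (-1)%Z) by lia.
    pose proof (Rabs_pos (y (-1)%Z T)).
    destruct Hcase as [Hl|[->|[->| ->]]]; try lra.
    specialize (HB l T Hl HT'). lra.
  - pose proof (jump_bound_scale) as Hv2.
    assert (Hd2 : 0 <= 7 * (a ^ 2 / e)) by lra.
    pose proof (outward_tail_of_jump _ _ Hd2 (Rle_refl 0) Hv2) as HB2.
    pose proof (outward_sum _ _ _ Hv2 HB2 T HT') as Hsum2.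
    specialize (Hv2 T HT').
    replace (0 / sqrt (rho e T)) with 0 in Hv2 by (unfold Rdiv; ring).
    assert (7 * (a ^ 2 / e) / pw e g T <= 7 * (a ^ 2 / e)) by (apply div_le; nra).
    pose proof (Rabs_other_le (y (-1)%Z T) (y 1%Z T) 0) as Hq2.
    rewrite Rabs_R0, Rminus_0_r, Rabs_minus_sym, (Rplus_comm (y 1%Z T)) in Hq2. lra.
  - intros Hlow Hup. set (Z := a ^ 2 / e) in *.
    assert (Hv2 : forall t, 0 <= t <= half_time j -> Rabs (y (-1)%Z t - y 1%Z t) <=
      (Rabs (growing 0) + 3 * (g * Rabs (y 0%Z 0) * (a / e)) + 12 / 10 * c) / (1 - 177 / 1000)
        / c / pw e g t + 0 / sqrt (rho e t)).
    { intros t Ht. pose proof (jump_bound t Ht) as H. pose proof (pw_pos e g t).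
      rewrite Rabs_mult, Rabs_pos_eq in H by nra.
      replace (0 / sqrt (rho e t)) with 0 by (unfold Rdiv; ring). rewrite Rplus_0_r.
      apply le_div; auto. apply le_div; auto. lra. }
    set (M := (Rabs (growing 0) + 3 * (g * Rabs (y 0%Z 0) * (a / e)) + 12 / 10 * c)
              / (1 - 177 / 1000)) in *.
    assert (Hae : 0 < a / e) by (apply Rdiv_lt_0_compat; auto).
    assert (Hf0pos : 0 <= y 0%Z 0) by lra.
    set (X := g * y 0%Z 0 * (a / e)).
    assert (HX : g * (8 / 100 * Z) <= X).
    { unfold X, Z. replace (g * (8 / 100 * (a ^ 2 / e))) with (g * (8 / 100 * a) * (a / e))
        by (field; lra).
      apply Rmult_le_compat_r; [lra|]. apply Rmult_le_compat_l; lra. }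
    assert (HMdef : M = (Rabs (growing 0) + 3 * X + 12 / 10 * c) / (1 - 177 / 1000)).
    { unfold M, X. rewrite (Rabs_pos_eq (y 0%Z 0)) by lra. reflexivity. }
    assert (HgZ : 0 <= g * (8 / 100 * Z)) by (apply Rmult_le_pos; lra).
    assert (HM : 0 <= M).
    { rewrite HMdef. pose proof (Rabs_pos (growing 0)). lra. }
    assert (HMc : 0 <= M / c) by (apply Rdiv_le_0_compat; lra).
    destruct (drift_of_jump _ 0 HMc (Rle_refl 0) Hv2 0 T (a / e)) as [_ H2]; try lra.
    { apply pw_rho_le_start. lra. }
    specialize (H2 Hf0pos). rewrite Rmult_0_l in H2.
    replace (c * (122 / 1000 * (M / c) + 18 / 100 * 0 + 1)) with (122 / 1000 * M + c) in H2
      by (field; lra).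
    assert (Hs : growing 0 <= 3 * (c * h) - X).
    { rewrite growing_start. fold X.
      assert (c * a * (y (-1)%Z 0 - y 1%Z 0) <= c * (3 * h)).
      { replace (3 / sqrt e) with (3 * h) in Hup by (unfold h; field; lra).
        apply Rle_trans with (c * a * (3 * h)).
        - apply Rmult_le_compat_l; nra.
        - assert (0 <= c * (3 * h)) by nra. nra. }
      lra. }
    assert (HN0 : Rabs (growing 0) <= - growing 0 + 6 * (c * h)).
    { assert (0 <= c * h) by nra. apply Rabs_le. lra. }
    assert (Hch : c * 1000 <= c * h) by (apply Rmult_le_compat_l; lra).
    assert (HNT : growing T <= - (32 / 1000 * (g * Z)) + 4 * (c * h)) by lra.
    assert (HcG2 : c * (64 / 1000 * c * Z - 4 * h) <= c * G).
    { rewrite HcG. assert (c ^ 2 * 2 * Z <= g * Z) by (apply Rmult_le_compat_r; lra).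
      pose proof (Rle_abs (- growing T)). rewrite Rabs_Ropp in H0. lra. }
    apply Rmult_le_reg_l in HcG2; auto. lra.
Qed.

End Outward.

(** * Crossing the resonance *)

(** The real system on the whole interval, crossing the resonance at t = 0. *)
Record flow (c e j : R) (x : Z -> R -> R) : Prop := {
  fl_cont : forall l t, - half_time (- j) <= t <= half_time j -> continuous (x l) t;
  fl_bdd : exists M, forall l t, - half_time (- j) <= t <= half_time j -> Rabs (x l t) <= M;
  fl_der : forall l t, - half_time (- j) < t < half_time j ->
    is_derive (x l) t (acoef c e j (l - 1) t * x (l - 1)%Z t
                       - acoef c e j (l + 1) t * x (l + 1)%Z t) }.

Lemma acoef_reflect c e j l t : acoef c e (- j) l t = acoef c e j (- l) (- t).
Proof. unfold acoef. rewrite opp_IZR. f_equal. ring. Qed.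

Lemma half_time_pos j : - (1 / 2) <= j <= 1 / 2 -> 0 < half_time j.
Proof. intros. apply Rinv_0_lt_compat. lra. Qed.

Section Halves.
Context (c e j : R) (x : Z -> R -> R) (Hj : 0 <= j <= 1 / 2)
  (Hx : flow c e j x) (k : R).

Lemma outgoing_half : half_flow c e j (fun l t => k * x l t).
Proof.
  pose proof (half_time_pos (- j) ltac:(lra)) as H1.
  destruct Hx as [Hcont [M HM] Hder]. split.
  - intros l t Ht. apply (continuous_scal_r (K := R_AbsRing) (V := R_NormedModule)).
    apply Hcont. lra.
  - exists (Rabs k * M). intros l t Ht. apply Rabs_mul_le; [lra|]. apply HM. lra.
  - intros l t Ht.
    replace (acoef c e j (l - 1) t * (k * x (l - 1)%Z t)
             - acoef c e j (l + 1) t * (k * x (l + 1)%Z t)) with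
      (k * (acoef c e j (l - 1) t * x (l - 1)%Z t
            - acoef c e j (l + 1) t * x (l + 1)%Z t)) by ring.
    apply is_derive_scal. apply Hder. lra.
Qed.

(** Reflecting t and l turns the half before the resonance, run backwards from the resonance, into a half
    flow with j of the opposite sign. *)
Lemma incoming_half : half_flow c e (- j) (fun l t => k * x (- l)%Z (- t)).
Proof.
  pose proof (half_time_pos j ltac:(lra)) as H1.
  destruct Hx as [Hcont [M HM] Hder]. split.
  - intros l t Ht. apply (continuous_scal_r (K := R_AbsRing) (V := R_NormedModule)).
    apply (continuous_comp (fun t => - t) (x (- l)%Z)).
    + apply (continuous_opp (K := R_AbsRing) (V := R_NormedModule)). apply continuous_id.
    + apply Hcont. lra.
  - exists (Rabs k * M). intros l t Ht. apply Rabs_mul_le; [lra|]. apply HM. lra.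
  - intros l t Ht.
    pose proof (Hder (- l)%Z (- t) ltac:(lra)) as D.
    rewrite !acoef_reflect.
    replace (- (l - 1))%Z with (- l + 1)%Z by lia.
    replace (- (l + 1))%Z with (- l - 1)%Z by lia.
    match type of D with is_derive _ _ ?d =>
      replace (acoef c e j (- l + 1) (- t) * (k * x (- l + 1)%Z (- t))
             - acoef c e j (- l - 1) (- t) * (k * x (- l - 1)%Z (- t))) with
      (k * (-1 * d)) by ring end.
    apply is_derive_scal.
    apply (is_derive_comp (x (- l)%Z) (fun t => - t)); [exact D|].
    auto_derive; auto. 
Qed.

End Halves.

(** The two halves glued at t = 0. The reflection exchanges the modes 1 and -1, which reverses the sign of
    the jump v. *)
Lemma resonance_crossing c e g j (x : Z -> R -> R) theta :
  regime c e g -> 0 <= j <= 1 / 2 -> flow c e j x -> 0 < theta ->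
  (forall l, Rabs (x l (- half_time (- j))) <= theta) ->
  (forall l, Rabs (x l (half_time j))
     <= 16 / 10 * Rabs (x (-1)%Z (half_time j)) + 3 / sqrt e * theta) /\
  Rabs (x (-1)%Z (half_time j)) <= 6 * (pw e g 0 ^ 2 / e) * theta /\
  (1 / 2 * theta <= x 0%Z (- half_time (- j)) ->
   (24 / 1000 * c * (pw e g 0 ^ 2 / e) - 3 / sqrt e) * theta
     <= Rabs (x (-1)%Z (half_time j))).
Proof.
  intros Hreg Hj Hx Hth Hinit.
  assert (Hk : 0 < / theta) by (apply Rinv_0_lt_compat; auto).
  pose proof (outgoing_half c e j x Hj Hx (/ theta)) as Hout.
  pose proof (incoming_half c e j x Hj Hx (/ theta)) as Hin.
  assert (Habs : forall r, Rabs (/ theta * r) = / theta * Rabs r).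
  { intros r. rewrite Rabs_mult, (Rabs_pos_eq (/ theta)); lra. }
  destruct (inward_conclusion c e g (- j) _ Hreg ltac:(lra) Hin) as [I1 [I2 [I3 [I4 I5]]]].
  { intros l. rewrite Habs. apply Rmult_le_reg_l with theta; auto.
    rewrite <- Rmult_assoc, Rinv_r, Rmult_1_l, Rmult_1_r by lra. apply Hinit. }
  change (- 0)%Z with 0%Z in *. change (- (-1))%Z with 1%Z in *. change (- (1))%Z with (-1)%Z in *.
  rewrite Ropp_0 in *.
  destruct (outward_conclusion c e g j _ Hreg Hj Hout) as [O1 [O2 O3]]; auto.
  - rewrite Rabs_minus_sym. exact I2.
  - rewrite Rplus_comm. exact I3.
  - intros l Hl. specialize (I4 (- l)%Z ltac:(lia)). rewrite Z.opp_involutive in I4. exact I4.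
  - cbv beta in *. set (T := half_time j) in *.
    assert (Hmul : forall r s, / theta * r <= s -> r <= s * theta).
    { intros r s H. apply Rmult_le_reg_l with (/ theta); auto.
      replace (/ theta * (s * theta)) with s by (field; lra). auto. }
    rewrite !Habs in *.
    split; [|split].
    + intros l. specialize (O1 l). rewrite !Habs in O1. apply Hmul in O1.
      replace (16 / 10 * Rabs (x (-1)%Z T) + 3 / sqrt e * theta) with
        ((16 / 10 * (/ theta * Rabs (x (-1)%Z T)) + 3 / sqrt e) * theta); auto.
      rewrite Rmult_plus_distr_r. f_equal. field. lra.
    + apply Hmul. auto.
    + intros Hhalf. 
      assert (H : 1 / 2 <= / theta * x 0%Z (- half_time (- j))).
      { apply Rmult_le_reg_r with theta; auto.
        replace (/ theta * x 0%Z (- half_time (- j)) * theta)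
          with (x 0%Z (- half_time (- j))) by (field; lra). auto. }
      destruct (I5 H) as [J1 J2]. specialize (O3 J1 ltac:(lra)).
      apply Rmult_le_compat_r with (r := theta) in O3; [|lra].
      replace (/ theta * Rabs (x (-1)%Z T) * theta) with (Rabs (x (-1)%Z T)) in O3
        by (field; lra). exact O3.
Qed.

(** Freezing a solution outside the closed interval gives plain continuity at its end points. *)
Definition clamp (a b t : R) : R := Rmax a (Rmin b t).

Lemma clamp_in a b t : a <= b -> a <= clamp a b t <= b.
Proof.
  intros. unfold clamp. split; [apply Rmax_l|].
  apply Rmax_lub; auto. apply Rmin_l.
Qed.

Lemma clamp_id a b t : a <= t <= b -> clamp a b t = t.
Proof. intros. unfold clamp. rewrite Rmin_right, Rmax_right; lra. Qed.

Lemma clamp_lip a b s t : Rabs (clamp a b s - clamp a b t) <= Rabs (s - t).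
Proof.
  unfold clamp, Rmax, Rmin.
  repeat destruct Rle_dec; split_Rabs; lra.
Qed.

Lemma continuous_clamped (U : UniformSpace) a b (f : R -> U) t :
  a <= b -> continuous_on (fun s => a <= s <= b) f ->
  continuous (fun s => f (clamp a b s)) t.
Proof.
  intros Hab Hf.
  pose proof (Hf (clamp a b t) (clamp_in a b t Hab)) as H.
  refine (filterlim_comp _ _ _ (clamp a b) f (locally t) _ _ _ H).
  intros P [eps HP]. exists eps. intros s Hs. apply HP.
  - apply Rle_lt_trans with (2 := Hs). apply clamp_lip.
  - apply clamp_in; auto.
Qed.

Lemma is_derive_clamped a b (f : R -> R) t d :
  a < t < b -> is_derive f t d -> is_derive (fun s => f (clamp a b s)) t d.
Proof.
  intros Ht. apply is_derive_ext_loc.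
  assert (Hpos : 0 < Rmin (t - a) (b - t)) by (apply Rmin_glb_lt; lra).
  exists (mkposreal _ Hpos). intros s Hs.
  assert (Hs' : Rabs (s - t) < Rmin (t - a) (b - t)) by exact Hs.
  pose proof (Rmin_l (t - a) (b - t)). pose proof (Rmin_r (t - a) (b - t)).
  rewrite clamp_id; auto. split_Rabs; lra.
Qed.

(** The real-linear functionals of norm at most 1 on the complex numbers when al^2 + be^2 <= 1. Composed
    with them a complex solution becomes a real one, and moduli are recovered as suprema. *)
Definition component (al be : R) (z : C) : R := al * fst z + be * snd z.

Lemma component_le al be z : al ^ 2 + be ^ 2 <= 1 -> Rabs (component al be z) <= Cmod z.
Proof.
  intros H. unfold component, Cmod. rewrite <- sqrt_Rsqr_abs. apply sqrt_le_1_alt.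
  unfold Rsqr. destruct z as [p q]. simpl.
  assert (0 <= (al * q - be * p) ^ 2) by apply pow2_ge_0.
  assert (0 <= (1 - (al ^ 2 + be ^ 2)) * (p ^ 2 + q ^ 2)) by (apply Rmult_le_pos; nra).
  nra.
Qed.

Lemma component_attained z :
  exists al be, al ^ 2 + be ^ 2 <= 1 /\ component al be z = Cmod z.
Proof.
  destruct (Req_dec (Cmod z) 0) as [H0|H0].
  - exists 1, 0. split; [lra|]. apply Cmod_eq_0 in H0. subst z.
    rewrite Cmod_0. unfold component. simpl. ring.
  - assert (Hs : fst z ^ 2 + snd z ^ 2 = Cmod z * Cmod z).
    { unfold Cmod. rewrite sqrt_sqrt; auto. apply Rplus_le_le_0_compat; apply pow2_ge_0. }
    exists (fst z / Cmod z), (snd z / Cmod z). split.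
    + right. replace ((fst z / Cmod z) ^ 2 + (snd z / Cmod z) ^ 2) with
        ((fst z ^ 2 + snd z ^ 2) / (Cmod z * Cmod z)) by (field; auto).
      rewrite Hs. field. auto.
    + unfold component. replace (fst z / Cmod z * fst z + snd z / Cmod z * snd z) with
        ((fst z ^ 2 + snd z ^ 2) / Cmod z) by (field; auto).
      rewrite Hs. field. auto.
Qed.

Lemma continuous_component al be (f : R -> C) t :
  continuous f t -> continuous (fun s => component al be (f s)) t.
Proof.
  intros H. apply (continuous_plus (K := R_AbsRing) (V := R_NormedModule));
    apply (continuous_scal_r (K := R_AbsRing) (V := R_NormedModule)).
  - apply (continuous_comp f (fun z : C => fst z)); auto.
    destruct (f t) as [p q]. apply (continuous_fst (U := R_UniformSpace) (V := R_UniformSpace)).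
  - apply (continuous_comp f (fun z : C => snd z)); auto.
    destruct (f t) as [p q]. apply (continuous_snd (U := R_UniformSpace) (V := R_UniformSpace)).
Qed.

Lemma is_derive_component al be (f : R -> C) t (d : C) :
  is_derive f t d -> is_derive (fun s => component al be (f s)) t (component al be d).
Proof.
  intros H. unfold component.
  apply (is_derive_plus (K := R_AbsRing) (V := R_NormedModule)); apply is_derive_scal.
  - apply (filterdiff_comp' f (fun z : C => fst z) t _ (fun z : C => fst z) H).
    apply filterdiff_linear. apply (is_linear_fst (K := R_AbsRing)
      (U := R_NormedModule) (V := R_NormedModule)).
  - apply (filterdiff_comp' f (fun z : C => snd z) t _ (fun z : C => snd z) H).
    apply filterdiff_linear. apply (is_linear_snd (K := R_AbsRing)
      (U := R_NormedModule) (V := R_NormedModule)).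
Qed.

Lemma coef_acoef c eta k0 l t : 0 < eta -> (2 <= k0)%Z ->
  coef c eta k0 (k0 + l) t = acoef c (/ xi eta k0) (/ IZR k0) l t.
Proof.
  intros Heta Hk. assert (2 <= IZR k0) by (apply IZR_le; auto).
  unfold coef, acoef, xi. rewrite plus_IZR. f_equal. field. lra.
Qed.

(** Changing the sign of every odd mode changes c into - c, which reduces to c > 0. *)
Definition parity_sign (c : R) (l : Z) : R := if Z.even l then 1 else sign c.

Lemma half_times k0 : (2 <= k0)%Z ->
  half_time (/ IZR k0) = tend k0 /\ - half_time (- / IZR k0) = tstart k0.
Proof.
  intros Hk. assert (2 <= IZR k0) by (apply IZR_le; auto).
  unfold half_time, tend, tstart. split; field; lra.
Qed.

Lemma sign_cases c : c <> 0 -> sign c * Rabs c = c /\ sign c * sign c = 1.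
Proof.
  intros Hc. destruct (Rlt_or_le 0 c).
  - rewrite sign_eq_1, Rabs_pos_eq; lra.
  - rewrite sign_eq_m1, Rabs_left by lra. lra.
Qed.

Lemma flow_of_solution c eta k0 u al be : c <> 0 -> 0 < eta -> (2 <= k0)%Z ->
  is_solution c eta k0 u ->
  flow (Rabs c) (/ xi eta k0) (/ IZR k0)
    (fun l t => parity_sign c l
       * component al be (u (k0 + l)%Z (clamp (tstart k0) (tend k0) t))).
Proof.
  intros Hc Heta Hk [Hcont [[M HM] Hder]].
  destruct (half_times k0 Hk) as [E1 E2].
  destruct (sign_cases c Hc) as [S1 S2].
  assert (Hk2 : 2 <= IZR k0) by (apply IZR_le; auto).
  assert (Hlt : tstart k0 < tend k0).
  { unfold tstart, tend.
    assert (0 < IZR k0 / (2 * (IZR k0 + 1))) by (apply Rdiv_lt_0_compat; lra).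
    assert (0 < IZR k0 / (2 * (IZR k0 - 1))) by (apply Rdiv_lt_0_compat; lra). lra. }
  assert (Hps : forall l, Rabs (parity_sign c l) <= 1).
  { intros l. unfold parity_sign. destruct Z.even; [rewrite Rabs_R1; lra|].
    apply Rabs_le. nra. }
  split; rewrite ?E1, ?E2.
  - intros l t Ht. apply (continuous_scal_r (K := R_AbsRing) (V := R_NormedModule)).
    apply continuous_component.
    apply (continuous_clamped C_UniformSpace (tstart k0) (tend k0) (u (k0 + l)%Z)); [lra|auto].
  - exists (1 * ((Rabs al + Rabs be) * M)). intros l t Ht.
    apply Rabs_mul_le; auto. rewrite clamp_id by auto.
    pose proof (HM (k0 + l)%Z t Ht) as HMl. set (z := u (k0 + l)%Z t) in *.
    assert (F1 : Rabs (fst z) <= M).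
    { apply Rle_trans with (2 := HMl). apply Rle_trans with (2 := Rmax_Cmod z). apply Rmax_l. }
    assert (F2 : Rabs (snd z) <= M).
    { apply Rle_trans with (2 := HMl). apply Rle_trans with (2 := Rmax_Cmod z). apply Rmax_r. }
    unfold component. rewrite Rmult_plus_distr_r.
    apply Rabs_add_le; apply Rabs_mul_le; auto; apply Rle_refl.
  - intros l t Ht.
    destruct (Hder (k0 + l)%Z t Ht) as [du [D Heq]].
    apply (is_derive_component al be) in D.
    assert (Hdu : component al be du =
      coef c eta k0 (k0 + l - 1) t * component al be (u (k0 + l - 1)%Z t)
      - coef c eta k0 (k0 + l + 1) t * component al be (u (k0 + l + 1)%Z t)).
    { destruct du as [d1 d2]. destruct (u (k0 + l + 1)%Z t) as [p1 p2].
      destruct (u (k0 + l - 1)%Z t) as [q1 q2].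
      injection Heq as H1 H2. unfold component. simpl. simpl in H1, H2.
      replace d1 with (coef c eta k0 (k0 + l - 1) t * q1 - coef c eta k0 (k0 + l + 1) t * p1) by lra.
      replace d2 with (coef c eta k0 (k0 + l - 1) t * q2 - coef c eta k0 (k0 + l + 1) t * p2) by lra.
      ring. }
    rewrite !clamp_id by lra.
    replace (k0 + l - 1)%Z with (k0 + (l - 1))%Z in Hdu by lia.
    replace (k0 + l + 1)%Z with (k0 + (l + 1))%Z in Hdu by lia.
    rewrite !coef_acoef in Hdu by auto.
    assert (Hac : forall l, acoef c (/ xi eta k0) (/ IZR k0) l t =
                    sign c * acoef (Rabs c) (/ xi eta k0) (/ IZR k0) l t).
    { intros m. unfold acoef. rewrite <- S1 at 1. unfold Rdiv. ring. }
    rewrite !Hac in Hdu.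
    assert (Hp1 : parity_sign c (l - 1) = parity_sign c l * sign c /\
                  parity_sign c (l + 1) = parity_sign c l * sign c).
    { unfold parity_sign. rewrite Z.even_sub, Z.even_add. simpl.
      destruct (Z.even l); simpl; lra. }
    destruct Hp1 as [P1 P2]. rewrite P1, P2.
    match goal with |- is_derive _ _ ?d =>
      replace d with (parity_sign c l * component al be du) by (rewrite Hdu; ring) end.
    apply is_derive_scal.
    apply (is_derive_clamped _ _ (fun s => component al be (u (k0 + l)%Z s)) t); auto.
Qed.

(** * The growth theorem *)

(** The smaller root of s (1 - s) = 2 c^2; the larger one is 1 - s, and their difference is gamma. *)
Definition slow_rate (c : R) : R := (1 - gamma c) / 2.

Lemma gamma_bounds c : 0 < Rabs c < 1 / 10 ->
  gamma c ^ 2 = 1 - 8 * c ^ 2 /\ 959 / 1000 <= gamma c < 1.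
Proof.
  intros Hc. assert (Hc2 : 0 < c ^ 2 < 1 / 100).
  { rewrite <- (pow2_abs c). nra. }
  unfold gamma. assert (Hs : sqrt (1 - 8 * c ^ 2) ^ 2 = 1 - 8 * c ^ 2) by (apply pow2_sqrt; lra).
  pose proof (sqrt_pos (1 - 8 * c ^ 2)).
  split; auto. split; nra.
Qed.

Lemma regime_of c e : 0 < Rabs c < 1 / 10 -> 0 < e <= 1 / 1000000 ->
  regime (Rabs c) e (slow_rate c).
Proof.
  intros Hc He. destruct (gamma_bounds c Hc) as [Hg [Hg1 Hg2]].
  split; auto; unfold slow_rate; try lra.
  rewrite pow2_abs. nra.
Qed.

(** The total amplification: a loss e^g on the way in and a gain e^(g-1) on the way out. *)
Lemma start_scale_eq c x : 0 < x ->
  pw (/ x) (slow_rate c) 0 ^ 2 / / x = Rpower x (gamma c).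
Proof.
  intros Hx. assert (Hi : 0 < / x) by (apply Rinv_0_lt_compat; auto).
  unfold pw. rewrite rho_0 by auto.
  assert (H : Rpower (/ x) (slow_rate c) = Rpower x (- slow_rate c)).
  { unfold Rpower. rewrite ln_Rinv by auto. f_equal. ring. }
  rewrite H. unfold Rdiv. rewrite Rinv_inv.
  rewrite <- (Rpower_1 x) at 2 by auto.
  simpl. rewrite Rmult_1_r, <- !Rpower_plus. f_equal. unfold slow_rate. field.
Qed.

(** Since gamma > 3/4, the errors of size xi^(1/2) are beaten by c xi^gamma as soon as
    xi^(1/4) >= 750 / |c|. *)
Lemma scale_dominates c x : 0 < Rabs c < 1 / 10 -> (750 / Rabs c) ^ 4 <= x ->
  1000000 <= x /\ 3 / sqrt (/ x) <= 4 / 1000 * Rabs c * Rpower x (gamma c).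
Proof.
  intros Hc Hx. destruct (gamma_bounds c Hc) as [_ [Hg _]].
  set (b := 750 / Rabs c) in *.
  assert (Hb : 7500 <= b) by (apply le_div; lra).
  assert (Hcb : Rabs c * b = 750) by (unfold b; field; lra).
  assert (Hb2 : 7500 * 7500 <= b * b) by nra.
  assert (Hb4 : (7500 * 7500) * (7500 * 7500) <= b ^ 4) by (replace (b ^ 4) with ((b * b) * (b * b)) by ring; nra).
  assert (Hx1 : 1000000 <= x) by lra. split; auto.
  assert (Hs : 0 < sqrt x) by (apply sqrt_lt_R0; lra).
  replace (3 / sqrt (/ x)) with (3 * sqrt x) by (rewrite sqrt_inv; field; lra).
  assert (H1 : Rpower x (1 / 2 + 1 / 4) <= Rpower x (gamma c)) by (apply Rle_Rpower; lra).
  rewrite Rpower_plus in H1.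
  replace (Rpower x (1 / 2)) with (sqrt x) in H1.
  2:{ rewrite <- Rpower_sqrt by lra. f_equal. field. }
  assert (H2 : b <= Rpower x (1 / 4)).
  { replace b with (Rpower (b ^ 4) (1 / 4)).
    - apply Rle_Rpower_l; [lra|]. split; auto. nra.
    - rewrite <- (Rpower_pow 4) by lra. rewrite Rpower_mult.
      replace (INR 4 * (1 / 4)) with 1 by (simpl; field). apply Rpower_1. lra. }
  assert (H3 : sqrt x * b <= Rpower x (gamma c)).
  { apply Rle_trans with (2 := H1). apply Rmult_le_compat_l; lra. }
  assert (H4 : Rabs c * (sqrt x * b) <= Rabs c * Rpower x (gamma c))
    by (apply Rmult_le_compat_l; lra).
  replace (Rabs c * (sqrt x * b)) with (sqrt x * 750) in H4 by (rewrite <- Hcb; ring).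
  lra.
Qed.

Section Transport.
Context (c eta : R) (k0 : Z) (u : Z -> R -> C) (theta : R)
  (Hc : 0 < Rabs c < 1 / 10) (Hk : (2 <= k0)%Z) (Heta : 0 < eta)
  (Hxi : (750 / Rabs c) ^ 4 <= xi eta k0) (Hu : is_solution c eta k0 u)
  (Hth : 0 < theta) (Hinit : forall k, Cmod (u k (tstart k0)) <= theta).

Let Z0 := Rpower (xi eta k0) (gamma c).

Lemma component_crossing al be : al ^ 2 + be ^ 2 <= 1 ->
  let x k t := Rabs (component al be (u k t)) in
  (forall k, x k (tend k0) <= 16 / 10 * x (k0 - 1)%Z (tend k0)
                              + 4 / 1000 * Rabs c * Z0 * theta) /\
  x (k0 - 1)%Z (tend k0) <= 6 * Z0 * theta /\
  (1 / 2 * theta <= component al be (u k0 (tstart k0)) ->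
   2 / 100 * Rabs c * Z0 * theta <= x (k0 - 1)%Z (tend k0)).
Proof.
  intros Hab. cbv zeta.
  destruct (scale_dominates c _ Hc Hxi) as [Hx1 Hx2]. fold Z0 in Hx2.
  assert (Hk2 : 2 <= IZR k0) by (apply IZR_le; auto).
  assert (Hc0 : c <> 0) by (intros ->; rewrite Rabs_R0 in Hc; lra).
  destruct (half_times k0 Hk) as [E1 E2]. destruct (sign_cases c Hc0) as [S1 S2].
  assert (He : 0 < / xi eta k0 <= 1 / 1000000).
  { split; [apply Rinv_0_lt_compat; lra|].
    replace (1 / 1000000) with (/ 1000000) by field. apply Rinv_le_contravar; lra. }
  assert (Hj : 0 <= / IZR k0 <= 1 / 2).
  { split; [apply Rlt_le, Rinv_0_lt_compat; lra|].
    replace (1 / 2) with (/ 2) by field. apply Rinv_le_contravar; lra. }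
  assert (Hps : forall l r, Rabs (parity_sign c l * r) = Rabs r).
  { intros l r. rewrite Rabs_mult. replace (Rabs (parity_sign c l)) with 1; [ring|].
    unfold parity_sign. destruct Z.even; [rewrite Rabs_R1; auto|].
    symmetry. destruct (Rlt_or_le 0 c).
    - rewrite sign_eq_1, Rabs_R1; auto.
    - rewrite sign_eq_m1, Rabs_left; lra. }
  assert (Hlt : tstart k0 < tend k0).
  { rewrite <- E1, <- E2.
    pose proof (half_time_pos (/ IZR k0) ltac:(lra)).
    pose proof (half_time_pos (- / IZR k0) ltac:(lra)). lra. }
  pose proof (flow_of_solution c eta k0 u al be Hc0 Heta Hk Hu) as Hfl.
  destruct (resonance_crossing _ _ _ _ _ theta (regime_of c _ Hc He) Hj Hfl Hth)
    as [R1 [R2 R3]].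
  - intros l. rewrite Hps, E2, clamp_id.
    + eapply Rle_trans; [apply component_le; auto | apply Hinit].
    + lra.
  - rewrite E1, E2 in *. rewrite start_scale_eq in R2, R3 by lra. fold Z0 in R2, R3.
    rewrite !clamp_id in * by lra. rewrite !Hps in *.
    change (k0 + -1)%Z with (k0 - 1)%Z in *.
    split; [|split]; auto.
    + intros k. specialize (R1 (k - k0)%Z). rewrite !Hps in R1.
      replace (k0 + (k - k0))%Z with k in R1 by lia.
      change (k0 + -1)%Z with (k0 - 1)%Z in R1.
      assert (3 / sqrt (/ xi eta k0) * theta <= 4 / 1000 * Rabs c * Z0 * theta)
        by (apply Rmult_le_compat_r; lra).
      lra.
    + intros Hhalf. rewrite Z.add_0_r in R3.
      change (parity_sign c 0) with 1 in R3. rewrite Rmult_1_l in R3.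
      specialize (R3 Hhalf).
      assert (2 / 100 * Rabs c * Z0 * theta
              <= (24 / 1000 * Rabs c * Z0 - 3 / sqrt (/ xi eta k0)) * theta)
        by (apply Rmult_le_compat_r; lra).
      lra.
Qed.

End Transport.

Theorem theorem5p10 :
  forall c : R, 0 < Rabs c < 1 / 10 ->
  exists Xi0 C1 C2 : R, 0 < Xi0 /\ 0 < C1 /\
  forall (k0 : Z) (eta : R) (u : Z -> R -> C) (theta : R),
    (2 <= k0)%Z -> 0 < eta -> Xi0 <= xi eta k0 ->
    is_solution c eta k0 u ->
    is_max_mod (fun k => u k (tstart k0)) theta ->
    Rle_C (1 / 2 * theta) (u k0 (tstart k0)) ->
    exists K : R, C1 <= K <= C2 /\
      (forall k : Z,
         Cmod (u k (tend k0)) <= K * Rpower (xi eta k0) (gamma c) * theta) /\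
      K / 2 * Rpower (xi eta k0) (gamma c) * theta
        <= Cmod (u (k0 - 1)%Z (tend k0)) /\
      exists m : R,
        is_max_mod (fun k => u k (tend k0)) m /\
        1 / 2 * m <= Cmod (u (k0 - 1)%Z (tend k0)).
Proof.
  intros c Hc.
  assert (Hb : 0 < 750 / Rabs c) by (apply Rdiv_lt_0_compat; lra).
  exists ((750 / Rabs c) ^ 4), (4 / 100 * Rabs c), 12.
  split; [apply pow_lt; auto|]. split; [lra|].
  intros k0 eta u theta Hk Heta Hxi Hu [Hub Hlub] [_ Hhalf].
  assert (Hinit : forall k, Cmod (u k (tstart k0)) <= theta) by (intros k; apply Hub; eauto).
  assert (Hth : 0 <= theta) by (apply Rle_trans with (2 := Hinit 0%Z); apply Cmod_ge_0).
  set (Z0 := Rpower (xi eta k0) (gamma c)).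
  assert (HZ0 : 0 < Z0) by apply exp_pos.
  set (q := Cmod (u (k0 - 1)%Z (tend k0))).
  assert (Hq0 : 0 <= q) by apply Cmod_ge_0.
  (* an arbitrary th >= theta is allowed so that theta = 0 can be treated by th -> 0 *)
  assert (Hall : forall th, 0 < th -> theta <= th -> forall k,
     Cmod (u k (tend k0)) <= 16 / 10 * q + 4 / 1000 * Rabs c * Z0 * th).
  { intros th Hth0 Hle k.
    destruct (component_attained (u k (tend k0))) as [al [be [Hab Hz]]].
    destruct (component_crossing c eta k0 u th Hc Hk Heta Hxi Hu Hth0) with al be
      as [H1 _]; auto.
    { intros l. apply Rle_trans with theta; auto. }
    specialize (H1 k). cbv beta in H1. rewrite Hz, Rabs_pos_eq in H1 by apply Cmod_ge_0.
    pose proof (component_le al be (u (k0 - 1)%Z (tend k0)) Hab). fold q in H.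
    fold Z0 in H1. lra. }
  assert (Hqle : forall th, 0 < th -> theta <= th -> q <= 6 * Z0 * th).
  { intros th Hth0 Hle.
    destruct (component_attained (u (k0 - 1)%Z (tend k0))) as [al [be [Hab Hz]]].
    destruct (component_crossing c eta k0 u th Hc Hk Heta Hxi Hu Hth0) with al be
      as [_ [H2 _]]; auto.
    { intros l. apply Rle_trans with theta; auto. }
    cbv beta in H2. rewrite Hz, Rabs_pos_eq in H2 by apply Cmod_ge_0. exact H2. }
  assert (Hlow : 0 < theta -> 2 / 100 * Rabs c * Z0 * theta <= q).
  { intros Hpos.
    destruct (component_crossing c eta k0 u theta Hc Hk Heta Hxi Hu Hpos) with 1 0
      as [_ [_ H3]]; auto; [lra|].
    cbv beta in H3.
    apply Rle_trans with (2 := component_le 1 0 _ ltac:(lra)). apply H3.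
    unfold component. unfold Re in Hhalf. lra. }
  assert (Hmax : forall k, Cmod (u k (tend k0)) <= 2 * q).
  { intros k. destruct (Rle_lt_or_eq_dec 0 theta Hth) as [Hpos|Hzero].
    - specialize (Hlow Hpos). specialize (Hall theta Hpos (Rle_refl _) k). lra.
    - apply le_epsilon. intros eps Heps.
      assert (HcZ : 0 < 4 / 1000 * Rabs c * Z0) by (apply Rmult_lt_0_compat; lra).
      assert (Hd : 0 < eps / (4 / 1000 * Rabs c * Z0)) by (apply Rdiv_lt_0_compat; auto).
      specialize (Hall _ Hd ltac:(lra) k).
      replace (4 / 1000 * Rabs c * Z0 * (eps / (4 / 1000 * Rabs c * Z0))) with eps in Hall
        by (field; lra).
      lra. }
  assert (Hm : exists m, is_max_mod (fun k => u k (tend k0)) m /\ 1 / 2 * m <= q).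
  { destruct (completeness (fun x => exists k : Z, x = Cmod (u k (tend k0)))) as [m Hm].
    - exists (2 * q). intros x [k ->]. auto.
    - exists q, (k0 - 1)%Z. reflexivity.
    - exists m. split; auto. assert (m <= 2 * q); [|lra].
      apply Hm. intros x [k ->]. auto. }
  destruct (Rle_lt_or_eq_dec 0 theta Hth) as [Hpos|Hzero].
  - assert (HZt : 0 < Z0 * theta) by (apply Rmult_lt_0_compat; auto).
    assert (HK : 2 * q / (Z0 * theta) * Z0 * theta = 2 * q) by (field; lra).
    specialize (Hlow Hpos). specialize (Hqle theta Hpos (Rle_refl _)).
    (* K is chosen so that the lower bound on u (k0 - 1) is an equality *)
    exists (2 * q / (Z0 * theta)). split; [split|split; [|split]]; auto.
    + apply le_div; auto. lra.
    + apply div_le; auto. lra.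
    + intros k. rewrite HK. auto.
    + replace (2 * q / (Z0 * theta) / 2 * Z0 * theta) with q by (field; lra). apply Rle_refl.
  - exists (4 / 100 * Rabs c). subst theta.
    assert (Hq : q <= 0).
    { apply le_epsilon. intros eps Heps.
      assert (Hd : 0 < eps / (6 * Z0)) by (apply Rdiv_lt_0_compat; lra).
      specialize (Hqle _ Hd ltac:(lra)).
      replace (6 * Z0 * (eps / (6 * Z0))) with eps in Hqle by (field; lra). lra. }
    rewrite !Rmult_0_r. split; [lra|]. split; [|split]; auto.
    intros k. specialize (Hmax k). lra.
Qed.
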